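(* Let $A$ be a locally $C^*$-algebra and let $E$ and $F$ be two Hilbert $A$-modules. If $T\in L_{M(A)}(M(E),M(F))$, then $T$ is strictly continuous, i.e. continuous from $M(E)$ with its strict topology to $M(F)$ with its strict topology.
   Context: A locally $C^*$-algebra is a complete Hausdorff complex topological $*$-algebra $A$ whose topology is determined by its continuous $C^*$-seminorms; $S(A)$ is the set of all continuous $C^*$-seminorms on $A$. A pre-Hilbert $A$-module is a complex vector space $E$ which is a right $A$-module (compatibly with the complex algebra structure), with an $A$-valued inner product $\langle\cdot,\cdot\rangle:E\times E\to A$ which is $\mathbb C$- and $A$-linear in the second variable, with $\langle\xi,\eta\rangle^*=\langle\eta,\xi\rangle$, $\langle\xi,\xi\rangle\ge 0$, and $\langle\xi,\xi\rangle=0$ iff $\xi=0$. It is a Hilbert $A$-module if it is complete for the topology given by the seminorms $\overline p_E(\xi)=\sqrt{p(\langle\xi,\xi\rangle)}$, $p\in S(A)$. $A$ is a Hilbert $A$-module with $\langle a,b\rangle=a^*b$. An $A$-module morphism $T:E\to F$ between Hilbert $A$-modules is adjointable if there is an $A$-module morphism $T^*:F\to E$ with $\langle T\xi,\eta\rangle=\langle\xi,T^*\eta\rangle$ for all $\xi\in E,\eta\in F$. $L_A(E,F)$ is the set of all such morphisms, and $L_A(E)=L_A(E,E)$, which is a locally $C^*$-algebra for the topology given by the seminorms sending $T$ to the norm of the operator it induces on the Hilbert $A/\ker p$-module $E/\ker\overline p_E$, $p\in S(A)$. The multiplier algebra $M(A)$ is identified with the locally $C^*$-algebra $L_A(A)$.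 The multiplier module of a Hilbert $A$-module $E$ is $M(E)=L_A(A,E)$, a Hilbert $M(A)$-module with action $t\cdot m=t\circ m$ and inner product $\langle s,t\rangle_{M(A)}=s^*\circ t$. $L_{M(A)}(M(E),M(F))$ is the set of adjointable $M(A)$-module morphisms from $M(E)$ to $M(F)$. The strict topology on $M(E)$ is the one generated by the seminorms $\|t\|_{p,a,\xi}=\overline p_E(t(a))+p(t^*(\xi))$, $(p,a,\xi)\in S(A)\times A\times E$. *)

(* Defs.v *)
From HB Require Import structures.
From mathcomp Require Import all_boot all_order all_algebra.
From mathcomp Require Import complex.
From mathcomp Require Import boolp classical_sets functions reals topology.
From mathcomp Require Import normedtype.

Set Implicit Arguments.
Unset Strict Implicit.
Unset Printing Implicit Defensive.

Import Order.TTheory GRing.Theory Num.Theory.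
Import numFieldNormedType.Exports.

Local Open Scope classical_set_scope.
Local Open Scope ring_scope.

Reserved Notation "a ** b" (at level 40, left associativity).
Reserved Notation "x <* a" (at level 40, left associativity).
Reserved Notation "<< x , y >>" (format "<< x ,  y >>").

Section SeminormTopology.
Context {R : realType} {V : zmodType}.

Definition seminorm_basis (P : set (V -> R)) : set (set V) :=
  [set B | exists n (p : 'I_n -> V -> R) (e : R),
    [/\ forall i, P (p i), 0 < e & B = [set v | forall i, p i v < e]]].

Definition seminorm_entourage (P : set (V -> R)) : set_system (V * V) :=
  filter_from (seminorm_basis P) (fun B => [set xy | B (xy.1 - xy.2)]).

(* [V] with the topology generated by the seminorms in [P]: a set is open iff
   around each of its points it contains a finite intersection of open balls.
   Being a topology does not depend on [P] consisting of seminorms. *)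
Definition seminormed (P : set (V -> R)) : Type := V.

Definition seminorm_open (P : set (V -> R)) (U : set (seminormed P)) :=
  forall x : V, U x -> exists2 B, seminorm_basis P B & forall v, B v -> U (x + v).

End SeminormTopology.

Section SeminormedTopological.
Context {R : realType} {V : zmodType} (P : set (V -> R)).

Lemma seminorm_openT : seminorm_open (P := P) setT.
Proof.
move=> x _; exists setT => //.
exists 0%N, (fun _ _ => 0), 1; split => //; first by case.
by apply/seteqP; split => v //= _ [].
Qed.

Lemma seminorm_openI (U W : set (seminormed P)) :
  seminorm_open U -> seminorm_open W -> seminorm_open (U `&` W).
Proof.
move=> oU oW x [Ux Wx].
have [_ [n [p [e [Pp e0 ->]]]] BU] := oU x Ux.
have [_ [m [q [d [Pq d0 ->]]]] BW] := oW x Wx.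
pose r (i : 'I_(n + m)) := match fintype.split i with inl j => p j | inr k => q k end.
exists [set v | forall i, r i v < Num.min e d].
  exists (n + m)%N, r, (Num.min e d); split => //; last by rewrite lt_min e0.
  by move=> i; rewrite /r; case: (fintype.split i).
move=> v rv; split.
- apply: BU => i; have := rv (lshift m i).
  by rewrite /r (unsplitK (inl i)) lt_min => /andP[].
- apply: BW => i; have := rv (rshift n i).
  by rewrite /r (unsplitK (inr i)) lt_min => /andP[].
Qed.

Lemma seminorm_open_bigU (I : Type) (U : I -> set (seminormed P)) :
  (forall i, seminorm_open (U i)) -> seminorm_open (\bigcup_i U i).
Proof.
move=> oU x [i _ Uix]; have [B PB BU] := oU i x Uix.
by exists B => // v Bv; exists i => //; exact: BU.
Qed.

HB.instance Definition _ := GRing.Zmodule.copy (seminormed P) V.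
HB.instance Definition _ := isOpenTopological.Build (seminormed P)
  seminorm_openT seminorm_openI seminorm_open_bigU.

End SeminormedTopological.

(* [completeType] would also require a distinguished point. *)
Definition complete_uniform (T : uniformType) : Prop :=
  forall F : set_system T, ProperFilter F -> cauchy F -> exists x : T, F --> x.

HB.mixin Record Lmodule_isStarAlgebra (R : realType) A & GRing.Lmodule R[i] A := {
  amul : A -> A -> A ;
  star : A -> A ;
  amulA : associative amul ;
  amulDl : left_distributive amul +%R ;
  amulDr : right_distributive amul +%R ;
  amulZl : forall (c : R[i]) a b, amul (c *: a) b = c *: amul a b ;
  amulZr : forall (c : R[i]) a b, amul a (c *: b) = c *: amul a b ;
  starD : {morph star : a b / a + b} ;
  starZ : forall (c : R[i]) a, star (c *: a) = c^* *: star a ;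
  starM : forall a b, star (amul a b) = amul (star b) (star a) ;
  starK : involutive star
}.

#[short(type="starAlgType")]
HB.structure Definition StarAlgebra (R : realType) :=
  {A of GRing.Lmodule R[i] A & Lmodule_isStarAlgebra R A}.

Notation "a ** b" := (amul a b) : ring_scope.

Section StarAlgebraDefs.
Context {R : realType} {A : starAlgType R}.

(* In a locally C*-algebra, equivalent to being self-adjoint with spectrum in
   [0, +oo[; this form needs no unit. *)
Definition positive (a : A) : Prop := exists b : A, a = star b ** b.

(* [p 0 = 0], [p (- a) = p a] and [0 <= p a] follow. *)
Definition seminorm (p : A -> R) : Prop :=
  (forall a b, p (a + b) <= p a + p b) /\
  (forall (c : R[i]) a, (p (c *: a))%:C%C = `|c| * (p a)%:C%C).

Definition cstar_seminorm (p : A -> R) : Prop :=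
  [/\ seminorm p,
      forall a b, p (a ** b) <= p a * p b &
      forall a, p (star a ** a) = p a ^+ 2].

End StarAlgebraDefs.

HB.structure Definition UniformStarAlgebra (R : realType) :=
  {A of Uniform A & StarAlgebra R A}.

Definition cstar_seminorms {R : realType} {A : UniformStarAlgebra.type R} :
  set (A -> R) := [set p | cstar_seminorm p /\ continuous p].
Arguments cstar_seminorms {R} A.

HB.mixin Record isLocallyCstar (R : realType) A & UniformStarAlgebra R A := {
  lcs_complete : complete_uniform A ;
  lcs_hausdorff : hausdorff_space A ;
  lcs_add_continuous : continuous (fun ab : A * A => ab.1 + ab.2) ;
  lcs_scale_continuous : continuous (fun ca : R[i]^o * A => ca.1 *: ca.2) ;
  lcs_mul_continuous : continuous (fun ab : A * A => ab.1 ** ab.2) ;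
  lcs_star_continuous : continuous (star : A -> A) ;
  lcs_entourageE : @entourage A = seminorm_entourage (cstar_seminorms A)
}.

#[short(type="locallyCstarType")]
HB.structure Definition LocallyCstar (R : realType) :=
  {A of UniformStarAlgebra R A & isLocallyCstar R A}.

(* A pre-Hilbert module without the condition [<<x, x>> >= 0]: adjointability
   involves neither positivity nor topology, and this part of the structure is
   all that is needed of the Hilbert M(A)-module M(E). *)
HB.mixin Record Lmodule_isInnerProductModule (R : realType) (A : starAlgType R) E
    & GRing.Lmodule R[i] E := {
  ract : E -> A -> E ;
  inner : E -> E -> A ;
  ractM : forall x a b, ract x (a ** b) = ract (ract x a) b ;
  ractDl : forall x y a, ract (x + y) a = ract x a + ract y a ;
  ractDr : forall x a b, ract x (a + b) = ract x a + ract x b ;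
  ractZl : forall (c : R[i]) x a, ract (c *: x) a = c *: ract x a ;
  ractZr : forall (c : R[i]) x a, ract x (c *: a) = c *: ract x a ;
  innerDr : forall x y z, inner x (y + z) = inner x y + inner x z ;
  innerZr : forall (c : R[i]) x y, inner x (c *: y) = c *: inner x y ;
  inner_ract : forall x y a, inner x (ract y a) = inner x y ** a ;
  star_inner : forall x y, star (inner x y) = inner y x ;
  inner_eq0 : forall x, inner x x = 0 -> x = 0
}.

#[short(type="innerProductModType")]
HB.structure Definition InnerProductModule (R : realType) (A : starAlgType R) :=
  {E of GRing.Lmodule R[i] E & Lmodule_isInnerProductModule R A E}.

Notation "x <* a" := (ract x a) : ring_scope.
Notation "<< x , y >>" := (inner x y) : ring_scope.

HB.mixin Record isPreHilbert (R : realType) (A : starAlgType R) E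
    & InnerProductModule R A E := {
  inner_ge0 : forall x : E, positive (<< x, x >> : A)
}.

#[short(type="preHilbertModType")]
HB.structure Definition PreHilbertModule (R : realType) (A : starAlgType R) :=
  {E of InnerProductModule R A E & isPreHilbert R A E}.

Definition pbar {R : realType} {A : starAlgType R} {E : innerProductModType A}
  (p : A -> R) (x : E) : R := Num.sqrt (p << x, x >>).

(* The uniform structure of [E] is not extra data: [hilbert_entourageE] forces it
   to be the one given by the seminorms [pbar p]. *)
HB.mixin Record isHilbert (R : realType) (A : locallyCstarType R) E
    & Uniform E & PreHilbertModule R A E := {
  hilbert_complete : complete_uniform E ;
  hilbert_entourageE :
    @entourage E = seminorm_entourage [set pbar p | p in cstar_seminorms A]
}.

#[short(type="hilbertModType")]
HB.structure Definition HilbertModule (R : realType) (A : locallyCstarType R) :=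
  {E of Uniform E & PreHilbertModule R A E & isHilbert R A E}.

Section Adjointable.
Context {R : realType} {A : starAlgType R}.
Implicit Types E F G : innerProductModType A.

Definition module_morphism E F (T : E -> F) : Prop :=
  [/\ {morph T : x y / x + y},
      forall (c : R[i]) x, T (c *: x) = c *: T x &
      forall x a, T (x <* a) = T x <* a].

Definition is_adjoint E F (T : E -> F) (T' : F -> E) : Prop :=
  forall x y, << T x, y >> = << x, T' y >>.

Definition is_adjointable E F (T : E -> F) : Prop :=
  module_morphism T /\ exists2 T', module_morphism T' & is_adjoint T T'.

Definition adjointable_pred E F : {pred E -> F} :=
  [pred T | `[< is_adjointable T >]].

(* L_A(E, F) *)
Record adjointable E F := Adjointable {
  adjointable_fun :> E -> F ;
  _ : adjointable_fun \in @adjointable_pred E F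
}.

HB.instance Definition _ E F := [isSub for @adjointable_fun E F].
HB.instance Definition _ E F := [Choice of adjointable E F by <:].

Lemma adjointableP E F (T : adjointable E F) : is_adjointable T.
Proof. by case: T => T /= /asboolP. Qed.

Lemma adjointable_ext E F (S T : adjointable E F) : S =1 T -> S = T.
Proof. by move=> ST; apply/val_inj/funext. Qed.

Lemma star0 : star (0 : A) = 0.
Proof. by apply: (addrI (star 0)); rewrite -starD !addr0. Qed.

Lemma innerDl E (x y z : E) : << x + y, z >> = << x, z >> + << y, z >> :> A.
Proof. by rewrite -star_inner innerDr starD !star_inner. Qed.

Lemma innerZl E (c : R[i]) (x y : E) : << c *: x, y >> = c^* *: << x, y >> :> A.
Proof. by rewrite -star_inner innerZr starZ star_inner. Qed.

Lemma innerNr E (x y : E) : << x, - y >> = - << x, y >> :> A.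
Proof. by rewrite -scaleN1r innerZr scaleN1r. Qed.

Lemma inner_ractl E (x y : E) (a : A) : << x <* a, y >> = star a ** << x, y >>.
Proof. by rewrite -star_inner inner_ract starM star_inner. Qed.

Lemma inner_ext E (x y : E) : (forall z, << z, x >> = << z, y >> :> A) -> x = y.
Proof.
move=> xy; apply/eqP; rewrite -subr_eq0; apply/eqP; apply: (@inner_eq0 _ A).
by rewrite innerDr innerNr xy subrr.
Qed.

Lemma inner0r E (x : E) : << x, 0 >> = 0 :> A.
Proof. by rewrite -[X in << _, X >>](scale0r 0) innerZr scale0r. Qed.

Lemma inner0l E (x : E) : << 0, x >> = 0 :> A.
Proof. by rewrite -star_inner inner0r star0. Qed.

Lemma ract0l E (a : A) : (0 : E) <* a = 0.
Proof. by rewrite -[X in X <* _](scale0r 0) ractZl scale0r. Qed.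

Lemma adjointable_submod E F : submod_closed (@adjointable_pred E F).
Proof.
split.
  apply/asboolP; split.
    by split=> [x y|c x|x a] /=; rewrite ?addr0 ?scaler0 ?ract0l.
  exists (fun _ => 0).
    by split=> [x y|c x|x a] /=; rewrite ?addr0 ?scaler0 ?ract0l.
  by move=> x y; rewrite inner0l inner0r.
move=> c S T /asboolP[[SD SZ SM] [S' [S'D S'Z S'M] SS']].
move=> /asboolP[[TD TZ TM] [T' [T'D T'Z T'M] TT']].
have E1 x : (c *: S + T) x = c *: S x + T x by [].
apply/asboolP; split.
  split=> [x y|d x|x a]; rewrite !E1.
  - by rewrite SD TD scalerDr addrACA.
  - by rewrite SZ TZ scalerDr !scalerA mulrC.
  - by rewrite SM TM ractDl ractZl.
exists (fun y => c^* *: S' y + T' y).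
  split=> [x y|d x|x a].
  - by rewrite S'D T'D scalerDr addrACA.
  - by rewrite S'Z T'Z scalerDr !scalerA mulrC.
  - by rewrite S'M T'M ractDl ractZl.
by move=> x y; rewrite E1 innerDl innerZl innerDr innerZr SS' TT'.
Qed.

HB.instance Definition _ E F :=
  GRing.isSubmodClosed.Build R[i] (E -> F) (@adjointable_pred E F)
    (@adjointable_submod E F).
HB.instance Definition _ E F :=
  [SubChoice_isSubLmodule of adjointable E F by <:].

Lemma adjointableD E F (S T : adjointable E F) x : (S + T) x = S x + T x.
Proof. by []. Qed.

Lemma adjointableZ E F (c : R[i]) (T : adjointable E F) x :
  (c *: T) x = c *: T x.
Proof. by []. Qed.

Lemma adj_subproof E F (T : adjointable E F) :
  sval (cid2 (adjointableP T).2) \in @adjointable_pred F E.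
Proof.
case: cid2 => T' mT' TT' /=; apply/asboolP; split=> //.
exists T; first by case: (adjointableP T).
by move=> x y; rewrite -star_inner -TT' star_inner.
Qed.

Definition adj E F (T : adjointable E F) : adjointable F E :=
  Adjointable (adj_subproof T).

Lemma adjE E F (T : adjointable E F) : is_adjoint T (adj T).
Proof. by rewrite /adj /=; case: cid2. Qed.

Lemma adj_uniq E F (T : adjointable E F) (T' : adjointable F E) :
  is_adjoint T T' -> adj T = T'.
Proof.
move=> TT'; apply: adjointable_ext => y; apply: inner_ext => x.
by rewrite -adjE TT'.
Qed.

Lemma module_morphism_comp E F G (S : F -> G) (T : E -> F) :
  module_morphism S -> module_morphism T -> module_morphism (S \o T).
Proof.
move=> [SD SZ SM] [TD TZ TM].
by split=> [x y|c x|x a] /=; rewrite ?TD ?TZ ?TM ?SD ?SZ ?SM.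
Qed.

Lemma comp_subproof E F G (S : adjointable F G) (T : adjointable E F) :
  S \o T \in @adjointable_pred E G.
Proof.
apply/asboolP; have [mS [S' mS' SS']] := adjointableP S.
have [mT [T' mT' TT']] := adjointableP T.
split; first exact: module_morphism_comp.
exists (T' \o S'); first exact: module_morphism_comp.
by move=> x y /=; rewrite SS' TT'.
Qed.

Definition adjointable_comp E F G (S : adjointable F G) (T : adjointable E F) :
  adjointable E G := Adjointable (comp_subproof S T).

Lemma adjointable_compA E F G H (S : adjointable G H) (T : adjointable F G)
    (U : adjointable E F) :
  adjointable_comp S (adjointable_comp T U) =
  adjointable_comp (adjointable_comp S T) U.
Proof. exact: adjointable_ext. Qed.

Lemma adjointable_compDl E F G (S T : adjointable F G) (U : adjointable E F) :
  adjointable_comp (S + T) U = adjointable_comp S U + adjointable_comp T U.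
Proof. exact: adjointable_ext. Qed.

Lemma adjointable_compDr E F G (S : adjointable F G) (T U : adjointable E F) :
  adjointable_comp S (T + U) = adjointable_comp S T + adjointable_comp S U.
Proof.
by apply: adjointable_ext => x; have [[SD _ _] _] := adjointableP S; exact: SD.
Qed.

Lemma adjointable_compZl E F G (c : R[i]) (S : adjointable F G)
    (T : adjointable E F) :
  adjointable_comp (c *: S) T = c *: adjointable_comp S T.
Proof. exact: adjointable_ext. Qed.

Lemma adjointable_compZr E F G (c : R[i]) (S : adjointable F G)
    (T : adjointable E F) :
  adjointable_comp S (c *: T) = c *: adjointable_comp S T.
Proof.
by apply: adjointable_ext => x; have [[_ SZ _] _] := adjointableP S; exact: SZ.
Qed.

Lemma adjD E F (S T : adjointable E F) : adj (S + T) = adj S + adj T.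
Proof.
by apply: adj_uniq => x y; rewrite !adjointableD innerDl innerDr !adjE.
Qed.

Lemma adjZ E F (c : R[i]) (T : adjointable E F) : adj (c *: T) = c^* *: adj T.
Proof.
by apply: adj_uniq => x y; rewrite !adjointableZ innerZl innerZr adjE.
Qed.

Lemma adj_comp E F G (S : adjointable F G) (T : adjointable E F) :
  adj (adjointable_comp S T) = adjointable_comp (adj T) (adj S).
Proof. by apply: adj_uniq => x y /=; rewrite !adjE. Qed.

Lemma adjK E F (T : adjointable E F) : adj (adj T) = T.
Proof. by apply: adj_uniq => x y; rewrite -star_inner -adjE star_inner. Qed.

HB.instance Definition _ E :=
  Lmodule_isStarAlgebra.Build R (adjointable E E)
    (@adjointable_compA E E E E)
    (@adjointable_compDl E E E) (@adjointable_compDr E E E)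
    (@adjointable_compZl E E E) (@adjointable_compZr E E E)
    (@adjD E E) (@adjZ E E) (@adj_comp E E E) (@adjK E E).

End Adjointable.

(* L_A(G, E) is a module over L_A(G), with [<<s, t>> = adj s \o t]; for [G] the
   algebra [A] itself this is the M(A)-module M(E). *)
Section AdjointableModule.
Context {R : realType} {A : starAlgType R} (G E : innerProductModType A).
Implicit Types (t s u : adjointable G E) (m : adjointable G G).

Definition adjointable_inner t s : adjointable G G := adjointable_comp (adj t) s.

Lemma adjointable_inner_ract t s m :
  adjointable_inner t (adjointable_comp s m) = adjointable_inner t s ** m.
Proof. exact: adjointable_compA. Qed.

Lemma star_adjointable_inner t s :
  star (adjointable_inner t s) = adjointable_inner s t.
Proof. by rewrite /star /= adj_comp adjK. Qed.

Lemma adjointable_inner_eq0 t : adjointable_inner t t = 0 -> t = 0.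
Proof.
move=> tt0; apply: adjointable_ext => x; apply: (@inner_eq0 _ A).
rewrite adjE; have -> : adj t (t x) = 0.
  by have := congr1 (fun f : adjointable G G => f x) tt0.
exact: inner0r.
Qed.

HB.instance Definition _ :=
  Lmodule_isInnerProductModule.Build R (adjointable G G) (adjointable G E)
    (fun t m n => adjointable_compA t m n)
    (fun t s m => adjointable_compDl t s m)
    (fun t m n => adjointable_compDr t m n)
    (fun c t m => adjointable_compZl c t m)
    (fun c t m => adjointable_compZr c t m)
    (fun t s u => adjointable_compDr (adj t) s u)
    (fun c t s => adjointable_compZr c (adj t) s)
    adjointable_inner_ract star_adjointable_inner adjointable_inner_eq0.

End AdjointableModule.

Definition regular_module (R : realType) (A : locallyCstarType R) : Type := A.

HB.instance Definition _ (R : realType) (A : locallyCstarType R) :=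
  GRing.Lmodule.copy (regular_module A) A.
HB.instance Definition _ (R : realType) (A : locallyCstarType R) :=
  Uniform.copy (regular_module A) A.

Section RegularModule.
Context {R : realType} {A : locallyCstarType R}.
Local Notation E := (regular_module A).
Implicit Types a b : A.

Lemma seminorm_ge0 (p : A -> R) a : seminorm p -> 0 <= p a.
Proof.
move=> [pD pZ].
have p0 : p 0 = 0.
  apply: (@complexI R); have := pZ 0 0; rewrite scaler0 normr0 mul0r => ->.
  by rewrite rmorph0.
have pN : p (- a) = p a.
  by apply: (@complexI R); rewrite -scaleN1r pZ normrN1 mul1r.
by have := pD a (- a); rewrite subrr p0 pN -mulr2n pmulrn_lge0.
Qed.

Lemma regular_definite a : star a ** a = 0 -> a = 0.
Proof.
move=> aa0; apply: (@lcs_hausdorff _ A) => X Y aX /nbhs_singleton Y0.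
move: aX; rewrite -nbhs_entourageE /= => -[D + DX].
rewrite lcs_entourageE => -[_ [n [p [e [Sp e0 ->]]]] BD].
exists 0; split=> //; apply/DX/xsectionP/BD => i /=; rewrite subr0.
have [[[_ pZ] _ pE] _] := Sp i.
have p0 : p i 0 = 0.
  by apply: (@complexI R); have := pZ 0 0; rewrite scaler0 normr0 mul0r.
by have := pE a; rewrite aa0 p0 => /esym/eqP; rewrite sqrf_eq0 => /eqP ->.
Qed.

Let star_regular_inner a b : star (star a ** b) = star b ** a.
Proof. by rewrite starM starK. Qed.

HB.instance Definition _ :=
  Lmodule_isInnerProductModule.Build R A E
    (fun x a b => amulA x a b) (fun x y a => amulDl x y a)
    (fun x a b => amulDr x a b)
    (fun c x a => amulZl c x a) (fun c x a => amulZr c x a)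
    (fun x y z => amulDr (star x) y z) (fun c x y => amulZr c (star x) y)
    (fun x y a => amulA (star x) y a)
    star_regular_inner regular_definite.

Let regular_inner_ge0 (x : E) : positive (<< x, x >> : A).
Proof. by exists x. Qed.

HB.instance Definition _ := isPreHilbert.Build R A E regular_inner_ge0.

Lemma pbar_regular (p : A -> R) : cstar_seminorm p -> pbar p = p :> (E -> R).
Proof.
move=> [sp _ pE]; apply/funext => a.
by rewrite /pbar [X in Num.sqrt X]pE sqrtr_sqr ger0_norm// seminorm_ge0.
Qed.

Let regular_complete : complete_uniform E.
Proof. exact: (@lcs_complete _ A). Qed.

Let regular_entourageE :
  @entourage E = seminorm_entourage [set pbar p | p in cstar_seminorms A].
Proof.
rewrite [LHS](@lcs_entourageE _ A); congr seminorm_entourage.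
apply/seteqP; split => [p Sp|_ [p Sp <-]].
  by exists p => //; rewrite pbar_regular//; case: Sp.
by rewrite pbar_regular//; case: Sp.
Qed.

HB.instance Definition _ :=
  isHilbert.Build R A E regular_complete regular_entourageE.

End RegularModule.

(* M(A), as the star-algebra L_A(A) *)
Definition multiplier_algebra (R : realType) (A : locallyCstarType R) : Type :=
  adjointable (regular_module A) (regular_module A).

HB.instance Definition _ (R : realType) (A : locallyCstarType R) :=
  StarAlgebra.on (multiplier_algebra A).

Section Multipliers.
Context {R : realType} {A : locallyCstarType R}.
Implicit Types E : hilbertModType A.

Definition multiplier E : Type := adjointable (regular_module A) E.

HB.instance Definition _ E := GRing.Lmodule.on (multiplier E).
HB.instance Definition _ E :=
  InnerProductModule.copy (multiplier E)
    (adjointable (regular_module A) E : innerProductModType (multiplier_algebra A)).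

Definition strict_seminorm E (p : A -> R) (a : A) (x : E) : multiplier E -> R :=
  fun t => pbar p (t a) + p (adj t x).

Definition strict_seminorms E : set (multiplier E -> R) :=
  [set q | exists (p : A -> R) (a : A) (x : E),
    cstar_seminorms A p /\ q = strict_seminorm p a x].

Definition strict E : Type := seminormed (@strict_seminorms E).

HB.instance Definition _ E := Topological.on (strict E).

End Multipliers.

(* Main.v *)
Require Import Defs.
From HB Require Import structures.
From mathcomp Require Import all_boot all_order all_algebra.
From mathcomp Require Import ring lra.
From mathcomp Require Import complex.
From mathcomp Require Import boolp classical_sets functions reals topology.
From mathcomp Require Import normedtype sequences.

Set Implicit Arguments.
Unset Strict Implicit.
Unset Printing Implicit Defensive.

Import Order.TTheory GRing.Theory Num.Theory.
Import numFieldNormedType.Exports.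

Local Open Scope classical_set_scope.
Local Open Scope ring_scope.

(** [T] restricts to a map on the rank-one multipliers [a |-> x <* a]: by Cohen
   factorization [x = z <* a], and [T] commutes with composition on the right, so
   it sends the multiplier of [x] to that of some [S x].  Then [S] is adjointable,
   [T t = S \o t], and the seminorm of [T t] given by [(p, a, y)] is controlled by
   the seminorm of [t] given by [(p, a, adj S y)] as soon as [S] is bounded for [p].

   Functional calculus and the order structure of C*-algebras are avoided.  The
   only analytic tool is the resolvent [(1 + k)^-1] of a skew-adjoint [k], which is
   a contraction for every C*-seminorm at once.  With [k = i c << x, x >>] it cuts
   a vector [x] off to [x (1 + k)^-1], whose norm is at most [sqrt (2 / c)] for all
   seminorms simultaneously; this uniformity replaces metrizability in the
   Cauchy-Schwarz inequality (up to a constant), in the factorization and in the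
   nested-ball proof that [S] is bounded. *)

(* The trivial square-zero extension [K (+) V]: it makes the linear identities of
   a module [V] provable by [ring]. *)
Definition sqzero (K : comNzRingType) (V : lmodType K) : Type := (K * V)%type.

Section SquareZero.
Context {K : comNzRingType} {V : lmodType K}.
Implicit Types x y z : sqzero V.

HB.instance Definition _ := GRing.Zmodule.on (sqzero V).

Let mul x y : sqzero V := (x.1 * y.1, x.1 *: y.2 + y.1 *: x.2).
Let one : sqzero V := (1, 0).

Let mulA : associative mul.
Proof.
move=> x y z; rewrite /mul /= mulrA !scalerDr !scalerA addrA.
by congr (_, _ + _ + _); rewrite ?(mulrC z.1) // mulrC.
Qed.

Let mulC : commutative mul.
Proof. by move=> x y; rewrite /mul mulrC addrC. Qed.

Let mul1 : left_id one mul.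
Proof. by case=> a u; rewrite /mul /= mul1r scale1r scaler0 addr0. Qed.

Let mulD : left_distributive mul +%R.
Proof.
move=> x y z; rewrite /mul /= mulrDl scalerDl scalerDr.
by congr (_, _); rewrite addrACA.
Qed.

Let one_neq0 : one != 0.
Proof. by apply/eqP => -[] /eqP; rewrite oner_eq0. Qed.

HB.instance Definition _ :=
  GRing.Zmodule_isComNzRing.Build (sqzero V) mulA mulC mul1 mulD one_neq0.

Definition sqzero_scalar (c : K) : sqzero V := (c, 0).
Definition sqzero_vector (v : V) : sqzero V := (0, v).

Let scalar_additive : zmod_morphism sqzero_scalar.
Proof. by move=> a b; congr (_, _); rewrite subr0. Qed.
HB.instance Definition _ := GRing.isZmodMorphism.Build _ _ _ scalar_additive.

Let scalar_multiplicative : monoid_morphism sqzero_scalar.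
Proof. by split=> // a b; congr (_, _); rewrite /= !scaler0 addr0. Qed.
HB.instance Definition _ := GRing.isMonoidMorphism.Build _ _ _ scalar_multiplicative.

Let vector_additive : zmod_morphism sqzero_vector.
Proof. by move=> u v; congr (_, _); rewrite subr0. Qed.
HB.instance Definition _ := GRing.isZmodMorphism.Build _ _ _ vector_additive.

Lemma sqzero_vector0 : sqzero_vector 0 = 0.
Proof. exact: raddf0. Qed.

Lemma sqzero_vectorD u v : sqzero_vector (u + v) = sqzero_vector u + sqzero_vector v.
Proof. exact: raddfD. Qed.

Lemma sqzero_vectorN u : sqzero_vector (- u) = - sqzero_vector u.
Proof. exact: raddfN. Qed.

Lemma sqzero_vectorZ c v : sqzero_vector (c *: v) = sqzero_scalar c * sqzero_vector v.
Proof. by congr (_, _); rewrite /= ?mulr0// scale0r addr0. Qed.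

Lemma sqzero_vector_inj : injective sqzero_vector.
Proof. by move=> u v []. Qed.

End SquareZero.

Ltac module :=
  apply: sqzero_vector_inj;
  rewrite ?(sqzero_vectorD, sqzero_vectorN, sqzero_vector0, sqzero_vectorZ); ring.

(** * Elementary properties of C*-seminorms *)

Section Seminorms.
Context {R : realType} {A : locallyCstarType R}.
Implicit Types (p : A -> R) (a b : A).

Lemma seminormD p a b : seminorm p -> p (a + b) <= p a + p b.
Proof. by case=> + _; exact. Qed.

Lemma seminormZ p (c : R[i]) a : seminorm p -> p (c *: a) = complex.Re `|c| * p a.
Proof.
move=> [_ /(_ c a) pZ]; have := congr1 (@complex.Re R) pZ.
by rewrite normc_def /= mul0r subr0.
Qed.

Lemma seminormZr p (r : R) a : seminorm p -> p (r%:C%C *: a) = `|r| * p a.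
Proof. by move=> sp; rewrite seminormZ// normc_def /= expr0n addr0 sqrtr_sqr. Qed.

Lemma seminormZi p a : seminorm p -> p ('i%C *: a) = p a.
Proof. by move=> sp; rewrite seminormZ// normc_def /= expr0n add0r expr1n sqrtr1 mul1r. Qed.

Lemma seminorm0 p : seminorm p -> p 0 = 0.
Proof. by move=> sp; rewrite -[0 in LHS](scale0r 0) (seminormZr 0 0 sp) normr0 mul0r. Qed.

Lemma seminormN p a : seminorm p -> p (- a) = p a.
Proof.
move=> sp; rewrite -scaleN1r -[-1 in LHS](rmorphN1 (@real_complex R)).
by rewrite (seminormZr _ _ sp) normrN1 mul1r.
Qed.

Lemma seminormB p a b : seminorm p -> p (a - b) <= p a + p b.
Proof. by move=> sp; rewrite -(seminormN b sp) seminormD. Qed.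

(** The C*-identity gives [p b ^+ 2 <= p (star b) * p b]; cancel [p b], then exchange [b] and
    [star b]. *)
Lemma cstar_star p a : cstar_seminorm p -> p (star a) = p a.
Proof.
move=> [sp pM pE].
have le b : p b <= p (star b).
  have [b0|] := eqVneq (p b) 0; first by rewrite b0 seminorm_ge0.
  move=> b0; have pb : 0 < p b by rewrite lt_neqAle eq_sym b0 seminorm_ge0.
  by rewrite -(ler_pM2r pb) -expr2 -pE pM.
by apply/eqP; rewrite eq_le le -{2}(starK a) le.
Qed.

Lemma cstar_mul_star p a : cstar_seminorm p -> p (a ** star a) = p a ^+ 2.
Proof. by move=> Sp; have [_ _ pE] := Sp; rewrite -{1}(starK a) pE cstar_star. Qed.

Lemma cstar0 : cstar_seminorm (fun _ : A => 0 : R).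
Proof.
split=> [|a b|a]; last by rewrite expr0n.
  by split=> *; rewrite ?addr0 ?rmorph0 ?mulr0.
by rewrite mulr0.
Qed.

Lemma cstar_max p q : cstar_seminorm p -> cstar_seminorm q ->
  cstar_seminorm (fun a => Num.max (p a) (q a)).
Proof.
move=> [sp pM pE] [sq qM qE].
have p0 a := seminorm_ge0 a sp; have q0 a := seminorm_ge0 a sq.
split.
- split=> [a b|c a].
    rewrite ge_max; apply/andP; split.
      by apply: le_trans (seminormD a b sp) _; rewrite lerD // le_max lexx.
    by apply: le_trans (seminormD a b sq) _; rewrite lerD // le_max lexx orbT.
  rewrite !seminormZ// -maxr_pMr ?normc_def ?sqrtr_ge0//.
  by rewrite rmorphM.
- move=> a b; rewrite ge_max; apply/andP; split.
    by apply: le_trans (pM a b) _; rewrite ler_pM // le_max lexx.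
  by apply: le_trans (qM a b) _; rewrite ler_pM // le_max lexx orbT.
- move=> a; rewrite pE qE; case: (leP (p a) (q a)) => pq.
    by apply/max_idPr; rewrite ler_sqr ?nnegrE.
  by apply/max_idPl; rewrite ler_sqr ?nnegrE // ltW.
Qed.

End Seminorms.

(** * Uniform structure, separation and completeness through seminorms *)

Section Topology.
Context {R : realType} {A : locallyCstarType R}.
Implicit Types (p q : A -> R) (a b : A) (E : hilbertModType A).

Lemma cstar_seminorms_seminorm q : cstar_seminorms A q -> seminorm q.
Proof. by case=> -[]. Qed.

Lemma cstar_seminorms_max p q : cstar_seminorms A p -> cstar_seminorms A q ->
  cstar_seminorms A (fun a => Num.max (p a) (q a)).
Proof.
move=> [Sp cp] [Sq cq]; split; first exact: cstar_max.
by move=> a; apply: (@continuous_max R A p q a); [exact: cp|exact: cq].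
Qed.

(** Directedness, so that a single seminorm suffices to test an entourage. The empty family is
    handled by the zero seminorm. *)
Lemma cstar_seminorms_dominate n (p : 'I_n -> A -> R) :
  (forall i, cstar_seminorms A (p i)) ->
  exists2 q, cstar_seminorms A q & forall i a, p i a <= q a.
Proof.
elim: n p => [p _|n IH p Sp].
  exists (fun=> 0); last by case.
  by split; [exact: cstar0|exact: cst_continuous].
have [q Sq qP] := IH (fun i => p (lift ord0 i)) (fun i => Sp _).
exists (fun a => Num.max (p ord0 a) (q a)); first exact: cstar_seminorms_max.
move=> i a; rewrite le_max; case: (unliftP ord0 i) => [j|] ->.
  by rewrite qP orbT.
by rewrite lexx.
Qed.

Lemma pbar_ge0 E p (x : E) : 0 <= pbar p x.
Proof. exact: sqrtr_ge0. Qed.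

Lemma sqr_pbar E p (x : E) : seminorm p -> pbar p x ^+ 2 = p << x, x >>.
Proof. by move=> sp; rewrite sqr_sqrtr// seminorm_ge0. Qed.

Lemma le_pbar E p q (x : E) : (forall a, p a <= q a) -> pbar p x <= pbar q x.
Proof. by move=> pq; exact: ler_wsqrtr. Qed.

Lemma pbarZr E p (r : R) (x : E) : seminorm p ->
  pbar p (r%:C%C *: x) = `|r| * pbar p x.
Proof.
move=> sp; rewrite /pbar innerZl innerZr scalerA.
rewrite [X in X *: _](_ : _ = (r ^+ 2)%:C%C).
  by rewrite seminormZr// ger0_norm ?sqr_ge0// sqrtrM ?sqr_ge0// sqrtr_sqr.
by apply/eqP; rewrite eq_complex /= !(mulr0, mul0r, oppr0, subr0, addr0) -expr2 !eqxx.
Qed.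

Lemma pbarZi E p (x : E) : pbar p ('i%C *: x) = pbar p x.
Proof.
rewrite /pbar innerZl innerZr scalerA.
rewrite [X in X *: _](_ : _ = 1) ?scale1r//.
apply/eqP; rewrite eq_complex /=.
by rewrite !(mulr0, mul0r, mulr1, mulN1r, opprK, sub0r, addr0, add0r, oppr0) !eqxx.
Qed.

Lemma pbarN E p (x : E) : pbar p (- x) = pbar p x.
Proof. by rewrite /pbar innerNr -(scaleN1r x) innerZl rmorphN1 scaleN1r opprK. Qed.

Lemma pbarBC E p (x y : E) : pbar p (x - y) = pbar p (y - x).
Proof. by rewrite -pbarN opprB. Qed.

Lemma hilbert_entourage_pbar E p (e : R) : cstar_seminorms A p -> 0 < e ->
  entourage [set xy : E * E | pbar p (xy.1 - xy.2) < e].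
Proof.
move=> Sp e0; rewrite hilbert_entourageE.
exists [set v | forall i : 'I_1, pbar p v < e]; last first.
  by move=> xy /= /(_ ord0).
exists 1%N, (fun=> pbar p), e; split=> // _.
by exists p.
Qed.

Lemma hilbert_entourageP E (U : set (E * E)) : entourage U ->
  exists p e, [/\ cstar_seminorms A p, 0 < e &
    forall x y, pbar p (x - y) < e -> U (x, y)].
Proof.
rewrite hilbert_entourageE => -[_ [n [f [e [Sf e0 ->]]]] fU].
have /choice[p pP] i : exists p, cstar_seminorms A p /\ pbar p = f i.
  by have [p Sp <-] := Sf i; exists p.
have [q Sq qP] := cstar_seminorms_dominate (fun i => proj1 (pP i)).
exists q, e; split=> // x y xy; apply: fU => i /=.
by rewrite -(proj2 (pP i)); apply: le_lt_trans xy; exact: le_pbar.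
Qed.

Lemma cstar_seminorms_separate a : (forall p, cstar_seminorms A p -> p a = 0) -> a = 0.
Proof.
move=> pa0; apply: (@lcs_hausdorff _ A) => X Y aX /nbhs_singleton Y0.
move: aX; rewrite -nbhs_entourageE /= => -[D + DX].
rewrite lcs_entourageE => -[_ [n [p [e [Sp e0 ->]]]] BD].
by exists 0; split=> //; apply/DX/xsectionP/BD => i /=; rewrite subr0 pa0.
Qed.

Lemma pbar_separate E (x : E) :
  (forall p, cstar_seminorms A p -> pbar p x = 0) -> x = 0.
Proof.
move=> px0; apply: (@inner_eq0 _ A); apply: cstar_seminorms_separate => p Sp.
by rewrite -sqr_pbar ?px0 ?expr0n//; exact: cstar_seminorms_seminorm.
Qed.

(* [B p e] plays the role of the set of solutions up to an error [e] measured by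
   [p]; no countable family of seminorms needs to determine the topology. *)
Lemma hilbert_complete_directed E (B : (A -> R) -> R -> set E) :
  (forall p (e : R), cstar_seminorms A p -> 0 < e -> B p e !=set0) ->
  (forall p q d e, (forall a, p a <= q a) -> d <= e -> B q d `<=` B p e) ->
  (forall p (e : R), cstar_seminorms A p -> 0 < e -> exists2 d : R, 0 < d &
     forall x y, B p d x -> B p d y -> pbar p (x - y) < e) ->
  exists x, forall p (e : R), cstar_seminorms A p -> 0 < e ->
    exists2 y, B p e y & pbar p (x - y) < e.
Proof.
move=> B0 Bmono Bcauchy.
pose D := [set pe : (A -> R) * R | cstar_seminorms A pe.1 /\ 0 < pe.2].
pose F := filter_from D (fun pe => B pe.1 pe.2).
have FF : ProperFilter F.
  apply: filter_from_proper; last by move=> [p e] [/= Sp e0]; exact: B0.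
  apply: filter_from_filter.
    exists (fun=> 0, 1); split=> //=.
    by split; [exact: cstar0|exact: cst_continuous].
  move=> [p d] [q e] [/= Sp d0] [/= Sq e0].
  exists (fun a => Num.max (p a) (q a), Num.min d e) => /=.
    by split=> /=; [exact: cstar_seminorms_max|rewrite lt_min d0].
  move=> x Bx; split; apply: (Bmono _ _ _ _ _ _ x Bx).
  - by move=> a; rewrite le_max lexx.
  - by rewrite ge_min lexx.
  - by move=> a; rewrite le_max lexx orbT.
  - by rewrite ge_min lexx orbT.
have Fcauchy : cauchy F.
  move=> U /hilbert_entourageP[p [e [Sp e0 pU]]].
  have [d d0 Bd] := Bcauchy p e Sp e0.
  exists (B p d, B p d); first by split; exists (p, d).
  by move=> [x y] [/= Bx By]; apply: pU; exact: Bd.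
have [x Fx] := hilbert_complete F FF Fcauchy.
exists x => p e Sp e0.
have FB : F (B p e) by exists (p, e).
have Fn : F [set y | pbar p (x - y) < e].
  apply: Fx; rewrite -nbhs_entourageE.
  exists [set xy : E * E | pbar p (xy.1 - xy.2) < e].
    exact: hilbert_entourage_pbar.
  by move=> y /xsectionP.
have [y [By xy]] := filter_ex (filterI FB Fn).
by exists y.
Qed.

End Topology.

(** * Solving equations for right multiplications *)

Lemma exists_expr_lt (R : realType) (k e : R) : 0 <= k -> k < 1 -> 0 < e ->
  exists n, k ^+ n < e.
Proof.
move=> k0 k1 e0; have k1' : `|k| < 1 by rewrite ger0_norm.
have /cvgrPdist_lt /(_ e e0) [n _ /(_ n (leqnn n))] := cvg_expr k1'.
by rewrite sub0r normrN ger0_norm ?exprn_ge0//; exists n.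
Qed.

Section RightMultiplication.
Context {R : realType} {A : locallyCstarType R}.
Implicit Types (p q : A -> R) (a b k r x y : A).

Lemma amulNl a b : - a ** b = - (a ** b).
Proof. by rewrite -scaleN1r amulZl scaleN1r. Qed.

Lemma amulNr a b : a ** - b = - (a ** b).
Proof. by rewrite -scaleN1r amulZr scaleN1r. Qed.

Lemma amul0l a : 0 ** a = 0.
Proof. by rewrite -[X in X ** _](scale0r 0) amulZl scale0r. Qed.

Lemma amul0r a : a ** 0 = 0.
Proof. by rewrite -[X in _ ** X](scale0r 0) amulZr scale0r. Qed.

Lemma starN a : star (- a) = - star a.
Proof. by rewrite -scaleN1r starZ rmorphN1 scaleN1r. Qed.

Definition amulE := (@amulDl R A, @amulDr R A, amulNl, amulNr, @amulZl R A,
  @amulZr R A, amul0l, amul0r, @amulA R A).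

(* Neumann series; the step [t] and the rate [k] may depend on [p]. *)
Lemma rmul_surjective (l : R[i]) a :
  (forall p, cstar_seminorms A p -> exists t k : R, [/\ 0 < t, 0 <= k, k < 1 &
     forall x, p (x - t%:C%C *: (l *: x + x ** a)) <= k * p x]) ->
  forall y, exists x, l *: x + x ** a = y.
Proof.
move=> contr y; pose L x := l *: x + x ** a.
have LB x z : L (x - z) = (L x - y) - (L z - y) by rewrite /L !amulE; module.
have Lle p x : cstar_seminorms A p -> p (L x) <= (complex.Re `|l| + p a) * p x.
  move=> [[sp pM _] _]; apply: le_trans (seminormD _ _ sp) _.
  by rewrite seminormZ// mulrDl lerD2l (le_trans (pM _ _))// mulrC.
pose B (p : A -> R) e : set (regular_module A) := [set x | p (L x - y) < e].
have [x Bx] : exists x : regular_module A, forall p (e : R), cstar_seminorms A p -> 0 < e ->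
    exists2 z, B p e z & pbar p (x - z) < e.
  apply: (hilbert_complete_directed (B := B)) => [p e Sp e0|p q d e pq de x|p e Sp e0].
  - have sp := cstar_seminorms_seminorm Sp.
    have [t [k [t0 k0 k1 kP]]] := contr p Sp.
    have approx n : exists x, p (L x - y) <= k ^+ n * p y.
      elim: n => [|n [x IH]].
        exists 0; rewrite (_ : L 0 - y = - y); last by rewrite /L amul0l; module.
        by rewrite seminormN// expr0 mul1r.
      (* This correction replaces the residual [L x - y] by its image under [1 - t L], which shrinks
         it by [k]. *)
      exists (x - t%:C%C *: (L x - y)); rewrite exprS -mulrA.
      apply: le_trans (ler_wpM2l k0 IH); apply: le_trans (kP _).
      rewrite [X in p X](_ : _ = (L x - y) - t%:C%C *: L (L x - y)) //.
      by rewrite /L !amulE; module.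
    have py : 0 < p y + 1 by rewrite ltr_wpDl// seminorm_ge0.
    have [n kn] := exists_expr_lt k0 k1 (divr_gt0 e0 py).
    have [x xP] := approx n; exists x; apply: le_lt_trans xP _.
    apply: le_lt_trans (_ : k ^+ n * (p y + 1) < e); last by rewrite -ltr_pdivlMr.
    by rewrite ler_wpM2l ?exprn_ge0// lerDl.
  - by move=> /= Bx; apply: le_lt_trans (pq _) (lt_le_trans Bx de).
  - have sp := cstar_seminorms_seminorm Sp.
    have [t [k [t0 k0 k1 kP]]] := contr p Sp.
    (* The contraction bounds [L] below: [(1 - k) * p u <= t * p (L u)]. Two points with residuals
       under this tolerance are therefore within [e]. *)
    exists ((1 - k) * e / (2 * t)); first by rewrite divr_gt0 ?mulr_gt0// subr_gt0.
    move=> x z /= Bx Bz; rewrite pbar_regular; last by case: Sp.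
    pose u : A := x - z.
    have ku : p u <= k * p u + t * p (L u).
      rewrite -{1}(subrK (t%:C%C *: L u) u).
      apply: le_trans (seminormD _ _ sp) _.
      by rewrite lerD ?kP// seminormZr// gtr0_norm.
    have : p (L u) < (1 - k) * e / (2 * t) *+ 2.
      by rewrite LB; apply: le_lt_trans (seminormB _ _ sp) _; rewrite mulr2n ltrD.
    rewrite -(ltr_pM2l t0) => Lu.
    have k1' : 0 < 1 - k by rewrite subr_gt0.
    rewrite -[p _]/(p u) -(ltr_pM2l k1').
    apply: le_lt_trans (_ : t * p (L u) < _); first by rewrite mulrBl mul1r lerBlDl.
    apply: lt_le_trans Lu _; rewrite le_eqVlt; apply/orP; left; apply/eqP.
    by field; rewrite gt_eqF.
exists x; apply/eqP; rewrite -subr_eq0; apply/eqP.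
apply: cstar_seminorms_separate => p Sp; have sp := cstar_seminorms_seminorm Sp.
apply/eqP; rewrite eq_le seminorm_ge0// andbT; apply/ler_addgt0Pr => e e0.
rewrite add0r; pose M := complex.Re `|l| + p a.
have M1 : 0 < M + 1.
  by rewrite ltr_wpDl// addr_ge0 ?seminorm_ge0// normc_def sqrtr_ge0.
have [z Bz xz] := Bx p (e / (M + 1)) Sp (divr_gt0 e0 M1).
rewrite pbar_regular in xz; last by case: Sp.
rewrite -[X in p X](_ : L (x - z) + (L z - y) = _); last by rewrite /L !amulE; module.
apply: le_trans (seminormD _ _ sp) _.
apply: le_trans (_ : M * (e / (M + 1)) + e / (M + 1) <= e).
  rewrite lerD ?(ltW Bz)// (le_trans (Lle _ _ Sp))// ler_wpM2l ?(ltW xz)//.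
  by rewrite addr_ge0 ?seminorm_ge0// normc_def sqrtr_ge0.
by rewrite -[X in _ + X]mul1r -mulrDl mulrC divfK// gt_eqF.
Qed.

End RightMultiplication.

(** * Resolvents of skew-adjoint elements *)

Section Resolvent.
Context {R : realType} {A : locallyCstarType R}.
Implicit Types (p q : A -> R) (a b k r x y : A).

Lemma starZr (r : R) a : star (r%:C%C *: a) = r%:C%C *: star a.
Proof. by rewrite starZ; congr (_ *: _); exact: conjc_real. Qed.

(* Arens' trick: the cross terms of [y ** star y] cancel. *)
Lemma skew_contraction p k x (t : R) : cstar_seminorm p -> star k = - k ->
  p ((1 - t)%:C%C *: x - t%:C%C *: (x ** k)) ^+ 2 <=
  ((1 - t) ^+ 2 + t ^+ 2 * p k ^+ 2) * p x ^+ 2.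
Proof.
move=> Sp ks; have [sp pM pE] := Sp.
rewrite -cstar_mul_star//.
rewrite [X in p X](_ : _ = ((1 - t) ^+ 2)%:C%C *: (x ** star x) +
    (t ^+ 2)%:C%C *: ((x ** k) ** star (x ** k))).
  apply: le_trans (seminormD _ _ sp) _.
  rewrite !seminormZr// !ger0_norm ?sqr_ge0// !cstar_mul_star// mulrDl lerD2l -[leRHS]mulrA.
  by rewrite ler_wpM2l ?sqr_ge0// -exprMn mulrC ler_sqr ?nnegrE ?mulr_ge0 ?seminorm_ge0.
by rewrite starD starN !starZr starM ks !amulE; module.
Qed.

(** Compare two bounds on [p (x - t (x + x ** k))] to first order in [t]: the triangle inequality
    gives at least [p x - t * p (x + x ** k)], and [skew_contraction] gives at most [(1 - t) * p x]
    up to [O(t ^+ 2)]. *)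
Lemma skew_rmul_ge p k x : cstar_seminorm p -> star k = - k -> p x <= p (x + x ** k).
Proof.
move=> Sp ks; have [sp pM pE] := Sp.
have [//|DP] := leP (p x) (p (x + x ** k)); exfalso.
set P := p x in DP *; set D := p (x + x ** k) in DP *.
have D0 : 0 <= D by exact: seminorm_ge0.
have P0 : 0 < P by exact: le_lt_trans DP.
pose N := 1 + p k ^+ 2; have N1 : 1 <= N by rewrite lerDl sqr_ge0.
have N0 : 0 < N by exact: lt_le_trans N1.
(* The two bounds yield [2 * P * (P - D) <= t * N * P ^+ 2]; this [t] turns the right-hand side into
   [P * (P - D)], a contradiction. *)
pose t := (P - D) / (P * N).
have t0 : 0 < t by rewrite divr_gt0 ?subr_gt0// mulr_gt0.
have tPN : t * (P * N) = P - D by rewrite /t divfK// gt_eqF// mulr_gt0.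
have t1 : t <= 1.
  rewrite ler_pdivrMr ?mulr_gt0// mul1r.
  by apply: le_trans (_ : P <= _); [rewrite gerBl|rewrite ler_peMr// ltW].
have := skew_contraction x t Sp ks; rewrite -/P.
set u := p _ => uP.
have Pu : P <= u + t * D.
  have -> : t * D = p (t%:C%C *: (x + x ** k)) by rewrite seminormZr// gtr0_norm.
  apply: le_trans (seminormD _ _ sp); rewrite le_eqVlt; apply/orP; left; apply/eqP.
  by congr p; module.
have tD : t * D <= D by rewrite ler_piMl.
have u2 : (P - t * D) ^+ 2 <= u ^+ 2.
  by rewrite ler_sqr ?nnegrE ?seminorm_ge0//; lra.
have {u2}uP := le_trans u2 uP.
have : t * (2 * P * (P - D)) <= t * (t * (P * N) * P).
  have: 0 <= (t * D) ^+ 2 by exact: sqr_ge0.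
  rewrite /N; nra.
rewrite tPN ler_pM2l//.
have : 0 < P * (P - D) by rewrite mulr_gt0// subr_gt0.
nra.
Qed.

(* [1 + r] is the inverse of [1 + k] in the unitization of [A]. *)
Lemma skew_resolvent k : star k = - k -> exists r,
  [/\ k + r + r ** k = 0,
      forall x, x ** k = k ** x -> x ** r = r ** x &
      forall p x, cstar_seminorm p -> p (x + x ** r) <= p x].
Proof.
move=> ks.
have [|r] := @rmul_surjective _ A 1 k _ (- k).
  move=> p [Sp _]; have [sp pM pE] := Sp.
  pose N := 1 + p k ^+ 2; have N1 : 1 <= N by rewrite lerDl sqr_ge0.
  have N0 : 0 < N by exact: lt_le_trans N1.
  (* The factor of [skew_contraction] is [1 - 2 t + t ^+ 2 * N], minimal at [t = N^-1] with value
     [1 - N^-1]. *)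
  exists N^-1, (Num.sqrt (1 - N^-1)); split; rewrite ?invr_gt0 ?sqrtr_ge0//.
    rewrite -[X in _ < X](@sqrtr1 R) ltr_sqrt// ltrBlDr ltrDl invr_gt0//.
  move=> x; rewrite -ler_sqr ?nnegrE ?mulr_ge0 ?sqrtr_ge0 ?seminorm_ge0//.
  rewrite exprMn sqr_sqrtr; last by rewrite subr_ge0 invf_le1.
  have := skew_contraction x N^-1 Sp ks.
  rewrite [X in p X ^+ 2 <= _](_ : _ = x - (N^-1)%:C%C *: (1 *: x + x ** k)); last by module.
  move=> /le_trans; apply; rewrite ler_wpM2r ?sqr_ge0//.
  rewrite le_eqVlt; apply/orP; left; apply/eqP.
  by rewrite (_ : p k ^+ 2 = N - 1) /N; [field; rewrite gt_eqF|ring].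
rewrite scale1r => rk; exists r.
have rE : r ** k = - k - r by rewrite -rk; module.
split=> [|x xk|p x Sp].
- by rewrite rE; module.
(* The commutator [d = x ** r - r ** x] satisfies [d + d ** k = 0], so [skew_rmul_ge] forces
   [p d = 0]. *)
- apply/eqP; rewrite -subr_eq0; apply/eqP; apply: cstar_seminorms_separate => p [Sp _].
  apply/eqP; rewrite eq_le seminorm_ge0; last by case: Sp.
  rewrite andbT; apply: le_trans (skew_rmul_ge _ Sp ks) _.
  rewrite [X in p X](_ : _ = 0); first by rewrite seminorm0//; case: Sp.
  rewrite amulDl amulNl -amulA rE -[X in _ + (_ - X)]amulA xk amulA rE.
  by rewrite !amulE xk; module.
- apply: le_trans (skew_rmul_ge _ Sp ks) _.
  by rewrite [X in p X](_ : _ = x)// amulDl -amulA rE !amulE; module.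
Qed.

End Resolvent.

(** * Cut-off of vectors and Cauchy-Schwarz up to a constant *)

Section CauchySchwarz.
Context {R : realType} {A : locallyCstarType R}.
Implicit Types (p q : A -> R) (a b k r : A) (E : hilbertModType A).

Lemma star_skew (c : R) a : star a = a ->
  star ('i%C *: (c%:C%C *: a)) = - ('i%C *: (c%:C%C *: a)).
Proof.
move=> sa; rewrite starZ starZr sa -scaleNr; congr (_ *: _).
by apply/eqP; rewrite eq_complex /= oppr0 !eqxx.
Qed.

Lemma ract0r E (x : E) : x <* (0 : A) = 0.
Proof. by rewrite -[X in _ <* X](scale0r 0) ractZr scale0r. Qed.

Lemma ractNr E (x : E) a : x <* (- a) = - (x <* a).
Proof. by rewrite -scaleN1r ractZr scaleN1r. Qed.

Lemma ractNl E (x : E) a : (- x) <* a = - (x <* a).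
Proof. by rewrite -scaleN1r ractZl scaleN1r. Qed.

(* On the submodule generated by [x] this gives the triangle inequality, before
   any Cauchy-Schwarz inequality is known. *)
Lemma pbar_cyclic E (x : E) : exists b, forall p (l : R[i]) a,
  cstar_seminorm p -> pbar p (l *: x + x <* a) = p (l *: b + b ** a).
Proof.
have [b xb] := @inner_ge0 _ _ _ x; exists b => p l a Sp.
have [sp _ pE] := Sp.
rewrite /pbar; set y := (l *: b + b ** a).
rewrite [X in p X](_ : _ = star y ** y) ?pE ?sqrtr_sqr ?ger0_norm ?seminorm_ge0//.
rewrite /y !(innerDl, innerDr, innerZl, innerZr, inner_ract, inner_ractl) xb.
by rewrite starD starZ starM !amulE; module.
Qed.

Lemma pbar_cyclic_le E p (x : E) (l : R[i]) a (K : R) : cstar_seminorm p ->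
  (forall b, p (l *: b + b ** a) <= K * p b) -> pbar p (l *: x + x <* a) <= K * pbar p x.
Proof.
move=> Sp le; have [b xb] := pbar_cyclic x.
rewrite xb//; apply: le_trans (le b) _.
by have := xb p 1 0 Sp; rewrite amul0r ract0r !addr0 !scale1r => ->.
Qed.

Lemma pbar_ract E p (x : E) a : cstar_seminorm p -> pbar p (x <* a) <= p a * pbar p x.
Proof.
move=> Sp; rewrite -[x <* a]add0r -(scale0r x); apply: pbar_cyclic_le => // b.
by rewrite scale0r add0r mulrC; case: Sp.
Qed.

Lemma pbar_rmul E p (x : E) a : cstar_seminorm p -> p a <= 1 ->
  pbar p (x + x <* a) <= 2 * pbar p x.
Proof.
move=> Sp a1; have [sp pM _] := Sp.
rewrite -[X in X + _]scale1r; apply: pbar_cyclic_le => // b.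
rewrite scale1r; apply: le_trans (seminormD _ _ sp) _.
have := pM b a; have := seminorm_ge0 b sp; nra.
Qed.

(** Contractivity at [star r] gives [p r ^+ 2 = p (star r ** r) <= 2 * p r]. *)
Lemma resolvent_le2 p r : cstar_seminorm p ->
  (forall x, p (x + x ** r) <= p x) -> p r <= 2.
Proof.
move=> Sp rP; have [sp _ pE] := Sp.
have := seminormB (star r + star r ** r) (star r) sp.
rewrite addrC addKr pE => /le_trans/(_ (lerD (rP _) (lexx _))).
rewrite cstar_star// => r2; have := seminorm_ge0 r sp; nra.
Qed.

(** The inner square is [(1 + star r) h (1 + r)]. Contractivity removes the left factor, and
    [c h (1 + r)] is [k (1 + r) = - r] up to a unimodular scalar, hence at most 2. *)
Lemma sqr_pbar_resolvent E p (x : E) (c : R) k r : 0 < c -> cstar_seminorm p ->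
  k = 'i%C *: (c%:C%C *: << x, x >>) -> k + r + r ** k = 0 -> k ** r = r ** k ->
  (forall y, p (y + y ** r) <= p y) -> pbar p (x + x <* r) ^+ 2 <= 2 / c.
Proof.
move=> c0 Sp kE rk kr rP; have [sp pM pE] := Sp.
rewrite sqr_pbar//; set h : A := << x, x >> in kE.
pose w := h + h ** r.
rewrite [X in p X](_ : _ = star (star w + star w ** r)); last first.
  rewrite starD starM starK /w !(innerDl, innerDr, inner_ract, inner_ractl) -/h.
  by rewrite !amulE; module.
rewrite cstar_star//; apply: le_trans (rP _) _; rewrite cstar_star//.
rewrite ler_pdivlMr// mulrC.
have -> : c * p w = p r.
  rewrite -(seminormN r sp) -(gtr0_norm c0) -seminormZr// -seminormZi//.
  congr p; rewrite /w; transitivity (k + k ** r); first by rewrite kE !amulE; module.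
  by rewrite kr -[RHS]add0r -rk; module.
exact: resolvent_le2.
Qed.

(** Trades a bound for one seminorm for a bound valid for all. With [k = i c ^- 2 << x, x >>], the
    scale ensures [p k <= 1], while [y = x (1 + k)^-1] is at most [sqrt 2 * c] everywhere. *)
Lemma hilbert_cutoff E p (x : E) (c : R) : cstar_seminorms A p -> 0 < c -> pbar p x <= c ->
  exists (y : E) (k : A), [/\ x = y + y <* k, p k <= 1 &
    forall q, cstar_seminorms A q -> pbar q y <= 2 * c].
Proof.
move=> Sp c0 xc; have [[sp pM pE] _] := Sp.
pose k : A := 'i%C *: ((c ^- 2)%:C%C *: << x, x >>).
have ks : star k = - k by apply: star_skew; exact: star_inner.
have [r [rk kr rP]] := skew_resolvent ks.
exists (x + x <* r), k; split.
- by rewrite ractDl -ractM -[LHS]addr0 -(ract0r x) -rk !ractDr; module.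
- rewrite seminormZi// seminormZr// -sqr_pbar// gtr0_norm ?invr_gt0 ?exprn_gt0//.
  rewrite mulrC ler_pdivrMr ?exprn_gt0// mul1r ler_sqr ?nnegrE ?pbar_ge0//.
  exact: ltW.
- move=> q [Sq _]; have c2 : 0 < c ^- 2 by rewrite invr_gt0 exprn_gt0.
  have := sqr_pbar_resolvent c2 Sq erefl rk (kr k erefl) (fun y => rP q y Sq).
  rewrite invrK => le; rewrite -ler_sqr ?nnegrE ?pbar_ge0 ?mulr_ge0// ?(ltW c0)//.
  apply: le_trans le _; have := sqr_ge0 c; rewrite exprMn; lra.
Qed.

(** Requiring [1 <= K] lets higher powers of [K] absorb lower ones. *)
Definition cauchy_schwarz E p (K : R) :=
  1 <= K /\ forall x y : E, p << x, y >> <= K * pbar p x * pbar p y.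

Lemma innerNl E (x y : E) : << - x, y >> = - << x, y >> :> A.
Proof. by rewrite -(scaleN1r x) innerZl rmorphN1 scaleN1r. Qed.

Lemma polarization E (x y : E) : 4%:R *: << x, y >> =
  (<< x + y, x + y >> - << x - y, x - y >>) +
  ('i%C *: << x - 'i%C *: y, x - 'i%C *: y >> -
   'i%C *: << x + 'i%C *: y, x + 'i%C *: y >>) :> A.
Proof.
have ci : (('i%C)^* : R[i]) = - 'i%C.
  by apply/eqP; rewrite eq_complex /= oppr0 !eqxx.
rewrite !(innerDl, innerDr, innerNr, innerZr, innerNl, innerZl) ci.
have ii (a : A) : 'i%C *: ('i%C *: a) = - a by rewrite scalerA -expr2 sqr_i scaleN1r.
by rewrite !(scalerDr, scaleNr, scalerN, ii); module.
Qed.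

(* The uniform structure of [E] is that of a topological group, which gives a
   bound by larger seminorms; the cut-off brings it back to [p]. *)
Lemma cauchy_schwarz_exists E p : cstar_seminorms A p -> exists K, cauchy_schwarz E p K.
Proof.
move=> Sp; have [[sp pM pE] _] := Sp.
have [V eV VU] := entourage_split_ex (@hilbert_entourage_pbar _ _ E _ _ Sp ltr01).
have [q [d [Sq d0 qV]]] := hilbert_entourageP eV.
(* Splitting the entourage through the midpoint 0 expresses continuity of addition at 0;
   polarization then bounds inner products of [q]-small vectors. *)
have add (x y : E) : pbar q x < d -> pbar q y < d -> p << x + y, x + y >> <= 1.
  move=> xd yd; have := VU (x, - y); rewrite /= opprK => xy.
  rewrite -sqr_pbar// expr_le1 ?pbar_ge0// ltW// xy//.
  by exists 0 => /=; apply: qV; rewrite ?subr0 ?sub0r ?opprK.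
have small (x y : E) : pbar q x < d -> pbar q y < d -> p << x, y >> <= 1.
  move=> xd yd; have := congr1 p (polarization x y).
  rewrite -[4%:R in X in X = _](rmorph_nat (@real_complex R)) seminormZr// ger0_norm//.
  have a1 := add x y xd yd.
  have a2 := add x (- y) xd; rewrite pbarN in a2; have {}a2 := a2 yd.
  have a3 := add x ('i%C *: y) xd; rewrite pbarZi in a3; have {}a3 := a3 yd.
  have a4 := add x (- ('i%C *: y)) xd; rewrite pbarN pbarZi in a4; have {}a4 := a4 yd.
  move=> e4; have := seminormD (<< x + y, x + y >> - << x - y, x - y >>)
    ('i%C *: << x - 'i%C *: y, x - 'i%C *: y >> -
     'i%C *: << x + 'i%C *: y, x + 'i%C *: y >>) sp; rewrite -e4.
  have := seminormB << x + y, x + y >> << x - y, x - y >> sp.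
  have := seminormB ('i%C *: << x - 'i%C *: y, x - 'i%C *: y >>)
     ('i%C *: << x + 'i%C *: y, x + 'i%C *: y >>) sp.
  rewrite !seminormZi//; lra.
(* Scaling brings [x] to [p]-size at most [d / 4], and the cut-off then has [q]-size at most
   [d / 2]. *)
have cut (x : E) (c : R) : 0 < c -> pbar p x <= c ->
    exists (y : E) (k : A), [/\ (d / (4 * c))%:C%C *: x = y + y <* k, p k <= 1 & pbar q y < d].
  move=> c0 xc; have d4 : 0 < d / 4 by rewrite divr_gt0.
  have [|y [k [yk k1 yP]]] := hilbert_cutoff (x := (d / (4 * c))%:C%C *: x) Sp d4.
    rewrite pbarZr// gtr0_norm ?divr_gt0 ?mulr_gt0//.
    apply: le_trans (ler_wpM2l _ xc) _; first by rewrite ltW// divr_gt0 ?mulr_gt0.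
    by rewrite le_eqVlt; apply/orP; left; apply/eqP; field; rewrite gt_eqF.
  by exists y, k; split=> //; apply: le_lt_trans (yP q Sq) _; lra.
(* After scaling, the inner product is [(1 + star k) w (1 + m)] with [p w <= 1], hence at most 4;
   undoing the scalings multiplies by [16 * b * c / d ^+ 2]. *)
have main (x y : E) (b c : R) : 0 < b -> 0 < c -> pbar p x <= b -> pbar p y <= c ->
    p << x, y >> <= 64 / d ^+ 2 * b * c.
  move=> b0 c0 xb yc.
  have [x' [k [xk k1 x'd]]] := cut x b b0 xb.
  have [y' [m [ym m1 y'd]]] := cut y c c0 yc.
  have w1 := small x' y' x'd y'd; set w : A := << x', y' >> in w1.
  have w2 : p (w + w ** m) <= 2.
    apply: le_trans (seminormD _ _ sp) _; have := pM w m.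
    have := seminorm_ge0 m sp; have := seminorm_ge0 w sp; nra.
  have : p << (d / (4 * b))%:C%C *: x, (d / (4 * c))%:C%C *: y >> <= 4.
    rewrite xk ym; rewrite [X in p X](_ : _ = (w + w ** m) + star k ** (w + w ** m)).
      apply: le_trans (seminormD _ _ sp) _; have := pM (star k) (w + w ** m).
      rewrite cstar_star; last by case: Sp.
      have := seminorm_ge0 (w + w ** m) sp; have := seminorm_ge0 k sp; nra.
    by rewrite !(innerDl, innerDr, inner_ract, inner_ractl) -/w !amulE; module.
  have d4 (e : R) : 0 < e -> 0 < d / (4 * e) by move=> e0; rewrite divr_gt0 ?mulr_gt0.
  rewrite innerZl innerZr (_ : _^* = (d / (4 * b))%:C%C); last exact: conjc_real.
  rewrite !seminormZr// !gtr0_norm ?d4// mulrA -ler_pdivlMl ?mulr_gt0 ?invr_gt0 ?mulr_gt0//.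
  move=> /le_trans; apply; rewrite le_eqVlt; apply/orP; left; apply/eqP.
  by field; rewrite !gt_eqF.
have d2 : 0 < 64 / d ^+ 2 by rewrite divr_gt0 ?exprn_gt0.
exists (1 + 64 / d ^+ 2); split=> [|x y]; first by rewrite lerDl ltW.
set K := 64 / d ^+ 2 in main d2 *.
have x0 := pbar_ge0 p x; have y0 := pbar_ge0 p y.
set P := pbar p x in main x0 *; set Q := pbar p y in main y0 *.
apply: le_trans (_ : K * P * Q <= _); last by rewrite mulrDl mulrDl lerDr mulr_ge0 ?mul1r.
apply/ler_addgt0Pr => e e0.
(* [main] needs positive bounds, so [P] and [Q] are enlarged by [s]; since [s <= 1], this costs at
   most [s * N <= e]. *)
pose N := K * (P + Q + 1).
have N0 : 0 < N by rewrite mulr_gt0// ltr_wpDl// addr_ge0.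
pose s := Num.min 1 (e / N).
have s0 : 0 < s by rewrite lt_min ltr01 divr_gt0.
have s1 : s <= 1 by rewrite ge_min lexx.
have sN : s * N <= e by rewrite -ler_pdivlMr// ge_min lexx orbT.
apply: le_trans (main x y (P + s) (Q + s) _ _ _ _) _; rewrite ?ltr_wpDl ?lerDl ?(ltW s0)//.
apply: le_trans (_ : K * P * Q + s * N <= _); last by rewrite lerD2l.
rewrite /N -subr_ge0.
rewrite [X in 0 <= X](_ : _ = K * (s * (1 - s))); last by ring.
by apply: mulr_ge0 (ltW d2) (mulr_ge0 (ltW s0) _); rewrite subr_ge0.
Qed.

(** Expanding only the second argument of [<< x + y, x + y >>] leaves a factor [pbar p (x + y)] to
    cancel. *)
Lemma pbarD_le E p K (x y : E) : seminorm p -> cauchy_schwarz E p K ->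
  pbar p (x + y) <= K * (pbar p x + pbar p y).
Proof.
move=> sp [K1 cs]; have [->|z0] := eqVneq (pbar p (x + y)) 0.
  by rewrite mulr_ge0 ?addr_ge0 ?pbar_ge0// (le_trans ler01).
have zp : 0 < pbar p (x + y) by rewrite lt_neqAle eq_sym z0 pbar_ge0.
rewrite -(ler_pM2l zp) -expr2 sqr_pbar// innerDr.
apply: le_trans (seminormD _ _ sp) _; apply: le_trans (lerD (cs _ _) (cs _ _)) _.
by rewrite le_eqVlt; apply/orP; left; apply/eqP; ring.
Qed.

End CauchySchwarz.

(** * Convergence of sequences with geometric increments *)

Section GeometricSequences.
Context {R : realType} {A : locallyCstarType R}.
Implicit Types (p q : A -> R) (E : hilbertModType A).

Lemma geometric_le (d : nat -> R) : (forall n, 0 < d n) ->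
  (forall n, d n.+1 <= d n / 2) -> forall n m, (n <= m)%N -> d m <= d n.
Proof.
move=> d0 dS n m /subnK <-; elim: (m - n)%N => [//|j IH].
by rewrite addSn; apply: le_trans IH; have := dS (j + n)%N; have := d0 (j + n)%N; lra.
Qed.

Lemma geometric_small (d : nat -> R) (e : R) : (forall n, 0 < d n) ->
  (forall n, d n.+1 <= d n / 2) -> 0 < e -> exists n, d n < e.
Proof.
move=> d0 dS e0.
have dle n : d n <= 2^-1 ^+ n * d 0%N.
  elim: n => [|n IH]; first by rewrite expr0 mul1r.
  by apply: le_trans (dS n) _; rewrite exprS; lra.
have [|||n dn] := @exists_expr_lt R 2^-1 (e / d 0%N).
- by rewrite invr_ge0.
- lra.
- by rewrite divr_gt0.
by exists n; apply: le_lt_trans (dle n) _; rewrite -ltr_pdivlMr.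
Qed.

(* The bounds [d n] do not depend on the seminorm, so a sequence suffices even
   though the topology need not be metrizable. *)
Lemma hilbert_geometric_cvg E (x : nat -> E) (d : nat -> R) :
  (forall n, 0 < d n) -> (forall n, d n.+1 <= d n / 2) ->
  (forall p n, cstar_seminorms A p -> pbar p (x n.+1 - x n) <= d n) ->
  exists y, forall p K, cstar_seminorms A p -> cauchy_schwarz E p K ->
    forall n, pbar p (y - x n) <= 3 * K ^+ 2 * d n.
Proof.
move=> d0 dS xd.
have dist p K n m : cstar_seminorms A p -> cauchy_schwarz E p K -> (n <= m)%N ->
    pbar p (x m - x n) <= 2 * K * d n.
  move=> Sp [K1 cs] /subnK <-; have [[sp _ _] _] := Sp.
  have K0 : 0 <= K by exact: le_trans K1.
  (* Increments are summed inside [<< z, _ >>], where [p] is subadditive; iterating [pbarD_le] would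
     accumulate powers of [K]. The sum telescopes because [d m <= 2 * (d m - d m.+1)]. *)
  have step z j : p << z, x (j + n)%N - x n >> <= K * pbar p z * (2 * (d n - d (j + n)%N)).
    elim: j => [|j IH]; first by rewrite add0n !subrr inner0r seminorm0// !mulr0.
    rewrite addSn -(subrK (x (j + n)%N) (x (j + n).+1)) -addrA innerDr.
    apply: le_trans (seminormD _ _ sp) _.
    apply: le_trans (lerD (cs _ _) IH) _; rewrite -mulrDr ler_wpM2l ?mulr_ge0 ?pbar_ge0//.
    by have := xd p (j + n)%N Sp; have := dS (j + n)%N; lra.
  set z := x _ - x n; have [->|z0] := eqVneq (pbar p z) 0.
    by rewrite !mulr_ge0// ltW.
  have zp : 0 < pbar p z by rewrite lt_neqAle eq_sym z0 pbar_ge0.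
  rewrite -(ler_pM2l zp) -expr2 sqr_pbar//; apply: le_trans (step _ _) _.
  rewrite [leRHS](_ : _ = K * pbar p z * (2 * d n)); last by ring.
  by rewrite ler_wpM2l ?mulr_ge0 ?pbar_ge0//; have := d0 (m - n + n)%N; lra.
pose B (p : A -> R) e : set E := [set y | exists2 n, y = x n & d n < e].
have [y yB] : exists y, forall p (e : R), cstar_seminorms A p -> 0 < e ->
    exists2 z, B p e z & pbar p (y - z) < e.
  apply: (hilbert_complete_directed (B := B)) => [p e Sp e0|p q b e pq be|p e Sp e0].
  - by have [n dn] := geometric_small d0 dS e0; exists (x n), n.
  - by move=> _ [n -> dn]; exists n => //; exact: lt_le_trans be.
  - have [K csK] := cauchy_schwarz_exists E Sp.
    have K0 : 0 < 2 * K by rewrite mulr_gt0//; case: csK => /(lt_le_trans ltr01).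
    exists (e / (2 * K)); first by rewrite divr_gt0.
    move=> _ _ [n -> dn] [m -> dm].
    have [nm|/ltnW mn] := leqP n m.
      rewrite pbarBC; apply: le_lt_trans (dist p K n m Sp csK nm) _.
      by rewrite mulrC -ltr_pdivlMr.
    apply: le_lt_trans (dist p K m n Sp csK mn) _.
    by rewrite mulrC -ltr_pdivlMr.
(* Some [x m] with [d m < d n] lies within [d n] of [y], and then [n <= m]. The constant comes from
   [K * (1 + 2 * K) <= 3 * K ^+ 2]. *)
exists y => p K Sp csK n; have [_ [m -> dm] ym] := yB p (d n) Sp (d0 n).
have nm : (n <= m)%N.
  by rewrite leqNgt; apply/negP => /ltnW /(geometric_le d0 dS); rewrite leNgt dm.
rewrite -(subrK (x m) y) -addrA.
apply: le_trans (pbarD_le _ _ (cstar_seminorms_seminorm Sp) csK) _.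
have [K1 _] := csK; have := dist p K n m Sp csK nm; have := d0 n.
have := pbar_ge0 p (y - x m); have := pbar_ge0 p (x m - x n); move: ym.
set u := pbar _ _; set v := pbar _ _ => ym v0 u0 dn vK.
apply: le_trans (_ : K * (d n + 2 * K * d n) <= _).
  by rewrite ler_wpM2l ?lerD ?(ltW ym)// (le_trans ler01).
rewrite -subr_ge0 [X in 0 <= X](_ : _ = K * (K - 1) * d n); last by ring.
by rewrite !mulr_ge0 ?subr_ge0 ?(ltW dn)// (le_trans ler01).
Qed.

End GeometricSequences.

(** * Cohen factorization in Hilbert modules *)

Section Factorization.
Context {R : realType} {A : locallyCstarType R}.
Implicit Types (p q : A -> R) (E : hilbertModType A).

(* Cohen's factorization: [v n = 1 + r n] is the resolvent of [<< x, x >>] at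
   scale [2 * 16 ^ n]; the elements [2 ^- n + g n = 1 - \sum_(k < n) 2 ^- k.+1 * v k]
   of the unitization are invertible, [g n] converges, and so does
   [y n = x (2 ^- n + g n)^-1]. *)
Lemma hilbert_factorization E (x : E) : exists (y : E) (a : A), x = y <* a.
Proof.
pose h : A := << x, x >>; have hs : star h = h by exact: star_inner.
pose c n : R := 2 * 16 ^+ n; pose k n : A := 'i%C *: ((c n)%:C%C *: h).
have c0 n : 0 < c n by rewrite mulr_gt0// exprn_gt0.
have /choice[r rP] n : exists r : A, [/\ k n + r + r ** k n = 0,
    forall a, a ** k n = k n ** a -> a ** r = r ** a &
    forall p a, cstar_seminorm p -> p (a + a ** r) <= p a].
  by apply: skew_resolvent; exact: star_skew.
have kh n a : a ** h = h ** a -> a ** k n = k n ** a.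
  by move=> ah; rewrite /k !amulE ah.
have hr n : r n ** h = h ** r n by have [_ /(_ h (kh n h erefl)) ->] := rP n.
have rr n m : r n ** r m = r m ** r n.
  by have [_ rm _] := rP m; apply: rm; apply: kh.
pose e n : R := 2 ^- n.
have e0 n : 0 < e n by rewrite invr_gt0 exprn_gt0.
have eS n : e n = 2 * e n.+1 by rewrite /e exprS invfM mulrA divff ?mul1r ?pnatr_eq0.
have f0 n : (2 : R) ^+ n != 0 by rewrite expf_neq0 ?pnatr_eq0.
have ef n : e n * 2 ^+ n = 1 by rewrite mulVf.
pose fix g n : A := if n is n'.+1 then g n' - (e n)%:C%C *: r n' else 0.
have gr n m : g n ** r m = r m ** g n.
  by elim: n => [|n IH] /=; rewrite !amulE// IH rr.
pose L n (a : A) := (e n)%:C%C *: a + a ** g n.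
(* [a - L n a] is the sum over [k < n] of [2 ^- k.+1] times [a (1 + r k)], and each [1 + r k] is a
   contraction. *)
have Lle n p a : cstar_seminorm p -> p (a - L n a) <= (1 - e n) * p a.
  move=> Sp; have [sp _ _] := Sp; elim: n => [|n IH].
    rewrite /L /e /= expr0 invr1 subrr mul0r amul0r.
    by rewrite [X in p X](_ : _ = 0) ?seminorm0//; module.
  rewrite [X in p X](_ : _ = (a - L n a) + (e n.+1)%:C%C *: (a + a ** r n)).
    apply: le_trans (seminormD _ _ sp) _; rewrite seminormZr// gtr0_norm//.
    have [_ _ /(_ p a Sp) ra] := rP n.
    apply: le_trans (lerD IH (ler_wpM2l (ltW (e0 _)) ra)) _.
    by rewrite (eS n); lra.
  by rewrite /L (eS n) /= !amulE; module.
have Lge n p a : cstar_seminorm p -> p a <= 2 ^+ n * p (L n a).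
  move=> Sp; have [sp _ _] := Sp.
  have := seminormD (a - L n a) (L n a) sp; rewrite subrK.
  move=> /le_trans/(_ (lerD (Lle n p a Sp) (lexx _))).
  by move=> le; rewrite -(ler_pM2l (e0 n)) mulrA ef; lra.
(* [2 ^+ n + s n] is the inverse of [2 ^- n + g n] in the unitization. *)
have /choice[s sP] n : exists s : A, L n s = - ((2 ^+ n)%:C%C *: g n).
  apply: rmul_surjective => p [Sp _]; exists 1, (1 - e n); split=> // [||a].
  - by rewrite subr_ge0 invf_le1 ?exprn_gt0// exprn_ege1// ler1n.
  - by rewrite gtrBl.
  - by rewrite scale1r; exact: Lle.
(* [b] models [x] inside [A]: increments of [y n = x (2 ^+ n + s n)] have the same size as those of
   [w n = b (2 ^+ n + s n)]. *)
have [b xb] := pbar_cyclic x.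
pose f n : R := 2 ^+ n.
have [y yE] : exists y : nat -> E, forall n, y n = (f n)%:C%C *: x + x <* s n.
  by exists (fun n => (f n)%:C%C *: x + x <* s n).
have [w wE] : exists w : nat -> A, forall n, w n = (f n)%:C%C *: b + b ** s n.
  by exists (fun n => (f n)%:C%C *: b + b ** s n).
have Lw n : L n (w n) = b.
  have := congr1 (fun a => b ** a) (sP n); rewrite /L wE !amulE => sn.
  rewrite scalerDr addrACA sn scalerA -rmorphM /= ef.
  by rewrite -/(f n); module.
have xbr p n : cstar_seminorms A p -> p (b + b ** r n) <= e n ^+ 2.
  move=> [Sp _]; have [rk kr rle] := rP n.
  have := xb p 1 (r n) Sp; rewrite !scale1r => <-.
  rewrite -ler_sqr ?nnegrE ?pbar_ge0 ?sqr_ge0//.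
  apply: le_trans (sqr_pbar_resolvent (c0 n) Sp erefl rk _ (fun a => rle p a Sp)) _.
    exact: kr.
  rewrite le_eqVlt; apply/orP; left; apply/eqP.
  rewrite /c /e (_ : 16 ^+ n = (2 ^+ n) ^+ 4); first by field.
  by rewrite -exprM mulnC exprM; congr (_ ^+ n); ring.
(* Inverting [L n.+1] costs [2 ^+ n.+1], cancelled by the coefficient [e n.+1]; inverting [L n]
   costs [2 ^+ n], against the [4 ^- n] that the scale [c n] provides in [xbr]. *)
have wd p n : cstar_seminorms A p -> p (w n.+1 - w n) <= e n.
  move=> Sp; have [[sp pM _] _] := Sp.
  have -> : e n = f n * e n ^+ 2 by rewrite expr2 mulrA (mulrC (f n)) ef mul1r.
  apply: le_trans (_ : f n * p (b + b ** r n) <= _); last first.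
    by rewrite ler_wpM2l ?xbr// exprn_ge0.
  have -> : b + b ** r n = L n (w n + w n ** r n).
    rewrite -{1}(Lw n) -[X in _ + X ** _](Lw n) /L !amulE -[w n ** r n ** g n]amulA.
    by rewrite -gr amulA; module.
  apply: le_trans (Lge n p _ _); last by case: Sp.
  apply: le_trans (Lge n.+1 p _ _) _; first by case: Sp.
  have -> : L n.+1 (w n.+1 - w n) = (e n.+1)%:C%C *: (w n + w n ** r n).
    transitivity (L n.+1 (w n.+1) - L n.+1 (w n)); first by rewrite /L !amulE; module.
    rewrite Lw -{1}(Lw n) /L (eS n) /= !amulE; module.
  by rewrite seminormZr// gtr0_norm// mulrA (mulrC (2 ^+ _)) ef mul1r.
have yd p n : cstar_seminorms A p -> pbar p (y n.+1 - y n) <= e n.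
  move=> Sp; apply: le_trans (wd p n Sp).
  have -> : y n.+1 - y n = ((f n.+1)%:C%C - (f n)%:C%C) *: x + x <* (s n.+1 - s n).
    by rewrite !yE ractDr ractNr; module.
  rewrite xb; last by case: Sp.
  rewrite le_eqVlt; apply/orP; left; apply/eqP; congr p.
  by rewrite !wE !amulE; module.
have ed n : e n.+1 <= e n / 2 by rewrite (eS n); lra.
have [z zP] := hilbert_geometric_cvg e0 ed yd.
have [a aP] : exists a : regular_module A, forall p K, cstar_seminorms A p ->
    cauchy_schwarz (regular_module A) p K ->
    forall n, pbar p (a - (g n : regular_module A)) <= 3 * K ^+ 2 * e n.
  apply: (hilbert_geometric_cvg e0 ed (E := regular_module A)) => p n Sp.
  have [Sp' _] := Sp; have [sp _ _] := Sp'.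
  rewrite pbar_regular// -[X in p X]/(g n - (e n.+1)%:C%C *: r n - g n).
  rewrite addrAC subrr add0r seminormN// seminormZr// gtr0_norm// (eS n) mulrC.
  rewrite ler_pM2r//; apply: resolvent_le2 => // u.
  by have [_ _] := rP n; exact.
exists z, a; apply/eqP; rewrite -subr_eq0; apply/eqP; apply: pbar_separate => p Sp.
have [Sp' _] := Sp; have [sp _ _] := Sp'.
have [K csK] := cauchy_schwarz_exists E Sp.
have [K' csK'] := cauchy_schwarz_exists (regular_module A) Sp.
have K0 : 0 <= K by case: csK => /(le_trans ler01).
have pD (u v : E) : pbar p (u + v) <= K * (pbar p u + pbar p v) by exact: pbarD_le.
pose Z := K * (pbar p z + 3 * K ^+ 2).
have e1 n : e n <= 1 by rewrite invf_le1 ?exprn_gt0// exprn_ege1// ler1n.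
have Z0 : 0 <= Z by rewrite mulr_ge0 ?addr_ge0 ?pbar_ge0 ?mulr_ge0 ?sqr_ge0.
have yZ n : pbar p (y n) <= Z.
  rewrite -(subKr z (y n)) /Z; apply: le_trans (pD _ _) _.
  rewrite pbarN ler_wpM2l ?lerD2l// (le_trans (zP p K Sp csK n))//.
  by rewrite ler_piMr ?mulr_ge0 ?sqr_ge0.
(* [M] collects the constants of the three terms of [x - z <* a = e n y n - y n (a - g n) - (z - y
   n) a], each [O(e n)]. *)
pose M := K * (K * (Z + 3 * K' ^+ 2 * Z) + p a * (3 * K ^+ 2)).
have M0 : 0 <= M.
  by rewrite !(sqr_ge0, pbar_ge0, mulr_ge0, addr_ge0, seminorm_ge0).
have small n : pbar p (x - z <* a) <= M * e n.
  have xE : x = (e n)%:C%C *: y n + y n <* g n.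
    rewrite yE scalerDr scalerA -rmorphM /= ef scale1r ractDl ractZl -ractM.
    have := congr1 (fun u => x <* u) (sP n); rewrite /L ractDr ractZr ractNr ractZr => sn.
    by rewrite addrACA sn -/(f n); module.
  have -> : x - z <* a = ((e n)%:C%C *: y n - y n <* (a - g n)) - (z - y n) <* a.
    by rewrite {1}xE ractDl ractDr ractNl ractNr; module.
  apply: le_trans (pD _ _) _; rewrite -mulrA ler_wpM2l// mulrDl lerD//.
    apply: le_trans (pD _ _) _; rewrite -mulrA ler_wpM2l// mulrDl lerD//.
      by rewrite pbarZr// gtr0_norm// mulrC ler_wpM2r// ltW.
    rewrite pbarN; apply: le_trans (pbar_ract _ _ Sp') _.
    rewrite mulrAC ler_pM ?seminorm_ge0 ?pbar_ge0//.
    by have := aP p K' Sp csK' n; rewrite pbar_regular.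
  rewrite pbarN; apply: le_trans (pbar_ract _ _ Sp') _.
  by rewrite -mulrA ler_wpM2l ?seminorm_ge0// zP.
apply/eqP; rewrite eq_le pbar_ge0 andbT; apply/ler_addgt0Pr => t t0; rewrite add0r.
have M1 : 0 < M + 1 by rewrite ltr_wpDl.
have [n en] := geometric_small e0 ed (divr_gt0 t0 M1).
apply: le_trans (small n) _; apply: le_trans (_ : (M + 1) * e n <= t).
  by rewrite ler_wpM2r ?lerDl// ltW.
by rewrite mulrC -ler_pdivlMr// ltW.
Qed.

End Factorization.

(** * Boundedness of adjointable maps for each seminorm *)

Section AutomaticBoundedness.
Context {R : realType} {A : locallyCstarType R}.
Implicit Types (p q : A -> R) (E F : hilbertModType A).

Lemma adjointable_lD E F (S : adjointable E F) x y : S (x + y) = S x + S y.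
Proof. by have [[SD _ _] _] := adjointableP S; exact: SD. Qed.

Lemma adjointable_lZ E F (S : adjointable E F) (c : R[i]) x : S (c *: x) = c *: S x.
Proof. by have [[_ SZ _] _] := adjointableP S; exact: SZ. Qed.

Lemma adjointable_ract E F (S : adjointable E F) x (a : A) : S (x <* a) = S x <* a.
Proof. by have [[_ _ SM] _] := adjointableP S; exact: SM. Qed.

Lemma adj_inner E F (S : adjointable E F) x y : << adj S y, x >> = << y, S x >> :> A.
Proof. by rewrite adjE adjK. Qed.

(** Writing [x = y (1 + k)] with [p k <= 1] gives [pbar p (S x) <= 2 * pbar p (S y)], so the cut-off
    [y] keeps half of the large value; a rescaled [y] is the witness. *)
Lemma unbounded_large E F (S : adjointable E F) p : cstar_seminorms A p ->
  (forall C, 0 <= C -> exists x, C * pbar p x < pbar p (S x)) ->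
  forall e N : R, 0 < e -> 0 <= N -> exists x,
    (forall q, cstar_seminorms A q -> pbar q x <= e) /\ N <= pbar p (S x).
Proof.
move=> Sp unb e N e0 N0; have [Sp' _] := Sp; have [sp _ _] := Sp'.
pose C := 4 * N / e; have C0 : 0 <= C by rewrite divr_ge0 ?mulr_ge0// ltW.
have [x xC] := unb C C0.
(* A positive bound slightly above [pbar p x], even when the latter is 0, that still satisfies
   [C * c <= pbar p (S x)]. *)
pose c := pbar p x + (pbar p (S x) - C * pbar p x) / (C + 1).
have C1 : 0 < C + 1 by rewrite ltr_wpDl.
have gap : 0 < (pbar p (S x) - C * pbar p x) / (C + 1) by rewrite divr_gt0// subr_gt0.
have c0 : 0 < c by rewrite ltr_wpDl// pbar_ge0.
have xc : pbar p x <= c by rewrite lerDl ltW.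
have Cc : C * c <= pbar p (S x).
  have : (C + 1) * c = C * pbar p x + pbar p x + (pbar p (S x) - C * pbar p x).
    by rewrite /c mulrDr mulrDl mul1r [(C + 1) * _]mulrC divfK// gt_eqF.
  by move: xc; lra.
have [y [k [xy k1 yc]]] := hilbert_cutoff Sp c0 xc.
have d0 : 0 < e / (2 * c) by rewrite divr_gt0// mulr_gt0.
exists ((e / (2 * c))%:C%C *: y); split=> [q Sq|].
  rewrite pbarZr; last exact: cstar_seminorms_seminorm.
  rewrite gtr0_norm// mulrAC ler_pdivrMr ?mulr_gt0// ler_pM2l//; exact: yc.
have Sy := pbar_rmul (S y) Sp' k1.
rewrite adjointable_lZ pbarZr// gtr0_norm//.
rewrite xy adjointable_lD adjointable_ract in Cc.
apply: le_trans (_ : e / (2 * c) * (C * c / 2) <= _); last first.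
  by rewrite ler_pM2l//; lra.
rewrite le_eqVlt; apply/orP; left; apply/eqP.
by rewrite /C; field; rewrite !gt_eqF.
Qed.

(* A nested-ball argument: the cut-off turns large values of [S] at [p]-small
   vectors into large values at vectors small for all seminorms at once. *)
Lemma adjointable_bounded E F (S : adjointable E F) p : cstar_seminorms A p ->
  exists2 C, 0 <= C & forall x, pbar p (S x) <= C * pbar p x.
Proof.
move=> Sp; have [Sp' _] := Sp; have [sp _ _] := Sp'.
apply: contrapT => nbd.
have /(unbounded_large Sp) large C : 0 <= C -> exists x, C * pbar p x < pbar p (S x).
  move=> C0; apply: contrapT => /forallNP xC; apply: nbd; exists C => // x.
  by rewrite leNgt; apply/negP; exact: xC.
have [K csK] := cauchy_schwarz_exists E Sp.
have [K' csK'] := cauchy_schwarz_exists F Sp.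
have K0 : 0 < K by case: csK => /(lt_le_trans ltr01).
have K'0 : 0 < K' by case: csK' => /(lt_le_trans ltr01).
(* From an index, a centre and a radius, produce a smaller ball on which [S] is at least the index.
   The pair [(0, 0)] is a default for nonpositive radii. *)
have step (s : nat * E * R) : exists t : E * R, 0 < s.2 ->
    [/\ 0 < t.2, t.2 <= s.2 / 2,
        forall q, cstar_seminorms A q -> pbar q (t.1 - s.1.2) <= s.2 &
        forall y, pbar p (y - t.1) <= 3 * K ^+ 2 * t.2 -> s.1.1%:R <= pbar p (S y)].
  case: s => -[n x] d /=; have [d0|_] := ltP 0 d; last by exists (0, 0).
  pose N : R := n%:R; have N0 : 0 <= N by exact: ler0n.
  have [||u [ud uN]] := large d (K' * ((K' * N + 2) + pbar p (S x))) => //.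
    by rewrite mulr_ge0 ?addr_ge0 ?mulr_ge0 ?pbar_ge0// ltW.
  have [z zE] : exists z, z = x + u by exists (x + u).
  have zN : K' * N + 2 <= pbar p (S z).
    rewrite -(lerD2r (pbar p (S x))) -(ler_pM2l K'0); apply: le_trans uN _.
    rewrite -[pbar p (S x) in leRHS]pbarN; apply: le_trans (pbarD_le _ _ sp csK').
    by rewrite zE adjointable_lD addrAC subrr add0r.
  (* The adjoint replaces the missing continuity of [S]: [<< S z, S z >> = << S z, S y >> - << adj S
     (S z), y - z >>], and the new radius makes the last term at most 1. *)
  pose G := pbar p (adj S (S z)); have G0 : 0 <= G by exact: pbar_ge0.
  have G1 : 0 < 3 * K ^+ 2 * (K * (G + 1)).
    by rewrite !mulr_gt0 ?exprn_gt0// ltr_wpDl.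
  exists (z, Num.min (d / 2) (3 * K ^+ 2 * (K * (G + 1)))^-1) => _ /=; split.
  - by rewrite lt_min divr_gt0//= invr_gt0.
  - by rewrite ge_min lexx.
  - by move=> q Sq; rewrite zE addrAC subrr add0r; exact: ud.
  move=> y yz; rewrite leNgt; apply/negP => SyN.
  have {}yz : K * (G + 1) * pbar p (y - z) <= 1.
    have KG : 0 < K * (G + 1) by rewrite mulr_gt0// ltr_wpDl.
    apply: le_trans (ler_wpM2l (ltW KG) yz) _.
    pose bound := (3 * K ^+ 2 * (K * (G + 1)))^-1.
    apply: le_trans (ler_wpM2l (ltW KG) (ler_wpM2l _ (_ : _ <= bound))) _.
    - by rewrite mulr_ge0 ?sqr_ge0.
    - by rewrite ge_min lexx orbT.
    by rewrite mulrA [K * _ * _]mulrC divff// gt_eqF.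
  have Szz : pbar p (S z) ^+ 2 <= K' * pbar p (S z) * pbar p (S y) + 1.
    rewrite sqr_pbar//.
    rewrite [X in p X](_ : _ = << S z, S y >> - << adj S (S z), y - z >>); last first.
      rewrite adj_inner -innerNr -innerDr -{1}(subrK z y) adjointable_lD.
      by rewrite addrAC subrr add0r.
    apply: le_trans (seminormB _ _ sp) _; rewrite lerD//; first by case: csK'.
    have [_ /(_ (adj S (S z)) (y - z)) cs] := csK.
    apply: le_trans cs _; apply: le_trans yz.
    by rewrite ler_wpM2r ?pbar_ge0// ler_wpM2l ?(ltW K0)// lerDl.
  rewrite -/N in SyN; move: Szz zN SyN.
  set P := pbar p (S z); set Q := pbar p (S y) => Szz zN QN.
  (* With [Q < N] this gives [P * (P - K' * N) <= 1], against [P >= K' * N + 2]. *)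
  have KPQ : K' * P * Q <= P * (K' * N).
    rewrite [leRHS]mulrCA mulrA; apply: ler_wpM2l (ltW QN).
    by rewrite mulr_ge0 ?pbar_ge0// ltW.
  have KN0 : 0 <= K' * N by rewrite mulr_ge0// ltW.
  nra.
have /choice[f fP] := step.
pose fix st n : E * R := if n is n'.+1 then f (n', (st n').1, (st n').2) else (0, 1).
have st0 n : 0 < (st n).2.
  by elim: n => [|n IH] //=; have [] := fP (n, (st n).1, (st n).2) IH.
have stP n := fP (n, (st n).1, (st n).2) (st0 n).
have [y yP] : exists y, forall q K, cstar_seminorms A q -> cauchy_schwarz E q K ->
    forall n, pbar q (y - (st n).1) <= 3 * K ^+ 2 * (st n).2.
  apply: hilbert_geometric_cvg => [//|n|q n Sq]; first by have [_ + _ _] := stP n.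
  by have [_ _ /(_ q Sq) + _] := stP n.
have Sy n : n%:R <= pbar p (S y).
  by have [_ _ _] := stP n; apply; exact: (yP p K Sp csK n.+1).
have := archi_boundP (pbar_ge0 p (S y)).
by rewrite ltNge Sy.
Qed.

End AutomaticBoundedness.

(** * Continuity from seminorm estimates *)

Section SeminormContinuity.
Context {R : realType} {V W : zmodType} (P : set (V -> R)) (Q : set (W -> R)).

Lemma seminormed_continuous (f : V -> W) : {morph f : x y / x + y} ->
  (forall q, Q q -> exists p C, [/\ P p, 0 <= C & forall x, q (f x) <= C * p x]) ->
  continuous (f : seminormed P -> seminormed Q).
Proof.
move=> fD bd; apply/continuousP => U; rewrite -[open U]/(seminorm_open U) => oU.
rewrite -[open _]/(@seminorm_open _ _ P (f @^-1` U)) => x Ux.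
have [_ [n [q [e [Qq e0 ->]]]] BU] := oU (f x) Ux.
have /choice[pC pCP] i : exists pC : (V -> R) * R,
    [/\ P pC.1, 0 <= pC.2 & forall y, q i (f y) <= pC.2 * pC.1 y].
  by have [p [C [Pp C0 pC]]] := bd _ (Qq i); exists (p, C).
pose M := 1 + \sum_i (pC i).2.
have CM i : (pC i).2 < M.
  rewrite /M (bigD1 i)//= addrCA ltrDl ltr_pwDl// sumr_ge0// => j _.
  by have [] := pCP j.
have M0 : 0 < M by rewrite ltr_pwDl// sumr_ge0// => j _; have [] := pCP j.
exists [set v | forall i, (pC i).1 v < e / M].
  exists n, (fun i => (pC i).1), (e / M); split=> //; last by rewrite divr_gt0.
  by move=> i; have [] := pCP i.
move=> v vM; rewrite /preimage /= fD; apply: BU => i.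
have [_ C0 /(_ v) /le_lt_trans] := pCP i; apply.
apply: le_lt_trans (_ : (pC i).2 * (e / M) < _); first by rewrite ler_wpM2l// ltW.
by rewrite mulrA ltr_pdivrMr// mulrC ltr_pM2l.
Qed.

End SeminormContinuity.

(** * Multiplier module maps as compositions with adjointable maps *)

Section Multipliers.
Context {R : realType} {A : locallyCstarType R}.
Implicit Types (E F : hilbertModType A).

Lemma rank_one_adjoint E (x : E) :
  is_adjoint (fun a : regular_module A => x <* a) (fun y : E => << x, y >>).
Proof. by move=> a y; exact: inner_ractl. Qed.

Lemma rank_one_subproof E (x : E) :
  (fun a : regular_module A => x <* a) \in @adjointable_pred R A (regular_module A) E.
Proof.
apply/asboolP; split.
  by split=> [a b|c a|a b]; [exact: ractDr|exact: ractZr|exact: ractM].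
exists (fun y : E => << x, y >>); last exact: rank_one_adjoint.
by split=> [y z|c y|y a]; [exact: innerDr|exact: innerZr|exact: inner_ract].
Qed.

(** The canonical embedding of [E] into its multiplier module. *)
Definition rank_one E (x : E) : adjointable (regular_module A) E :=
  Adjointable (rank_one_subproof x).

Lemma adj_rank_one E (x y : E) : adj (rank_one x) y = << x, y >>.
Proof. by apply: inner_ext => a; rewrite -adjE; exact: rank_one_adjoint. Qed.

(** For [z = x - y], the choice [a = << z, z >>] makes the square of the self-adjoint [<< z, z >>]
    vanish. *)
Lemma ract_inj E (x y : E) : (forall a : A, x <* a = y <* a) -> x = y.
Proof.
move=> xy; apply/eqP; rewrite -subr_eq0; apply/eqP.
have z0 (a : A) : (x - y) <* a = 0 by rewrite ractDl ractNl xy subrr.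
apply: (@inner_eq0 _ A); apply: regular_definite.
by rewrite star_inner -inner_ract z0 inner0r.
Qed.

Lemma rank_one_inj E : injective (@rank_one E).
Proof. by move=> x y xy; apply: ract_inj => a; rewrite -[x <* a]/(rank_one x a) xy. Qed.

Lemma comp_rank_one E F (t : adjointable E F) (x : E) :
  adjointable_comp t (rank_one x) = rank_one (t x).
Proof. by apply: adjointable_ext => a; exact: adjointable_ract. Qed.

Lemma rank_oneD E (x y : E) : rank_one (x + y) = rank_one x + rank_one y.
Proof. by apply: adjointable_ext => a; exact: ractDl. Qed.

Lemma rank_oneZ E (c : R[i]) (x : E) : rank_one (c *: x) = c *: rank_one x.
Proof. by apply: adjointable_ext => a; exact: ractZl. Qed.

Lemma rank_one_ract E (x : E) (a : A) :
  rank_one (x <* a) = adjointable_comp (rank_one x) (rank_one (a : regular_module A)).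
Proof. by rewrite comp_rank_one. Qed.

Section MultiplierModuleMap.
Context {E F : hilbertModType A}.
Implicit Type T : @adjointable R (multiplier_algebra A) (multiplier E) (multiplier F).

Lemma multiplier_mapM T (t : multiplier E) (m : multiplier_algebra A) :
  T (adjointable_comp t m) = adjointable_comp (T t) m.
Proof. by have [[_ _ TM] _] := adjointableP T; exact: TM. Qed.

Lemma multiplier_map_rank_one T (x : E) : exists y : F, T (rank_one x) = rank_one y.
Proof.
have [z [a ->]] := hilbert_factorization x.
by exists (T (rank_one z) a); rewrite rank_one_ract multiplier_mapM comp_rank_one.
Qed.

End MultiplierModuleMap.

Lemma multiplier_map_restrict E F
    (T : @adjointable R (multiplier_algebra A) (multiplier E) (multiplier F)) :
  exists S : adjointable E F, forall x, T (rank_one x) = rank_one (S x).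
Proof.
have /choice[S TS] := multiplier_map_rank_one T.
have /choice[S' TS'] := multiplier_map_rank_one (adj T).
have mor (E1 F1 : hilbertModType A)
    (T1 : @adjointable R (multiplier_algebra A) (multiplier E1) (multiplier F1))
    (S1 : E1 -> F1) : (forall x, T1 (rank_one x) = rank_one (S1 x)) -> module_morphism S1.
  move=> TS1; have [[TD TZ _] _] := adjointableP T1.
  split=> [x y|c x|x a]; apply: rank_one_inj; rewrite -TS1.
  - by rewrite !rank_oneD -!TS1; exact: TD.
  - by rewrite !rank_oneZ -!TS1; exact: TZ.
  - by rewrite !rank_one_ract -!TS1; exact: multiplier_mapM.
(* The [M(A)]-valued inner product of [rank_one x] and [rank_one y] is [rank_one << x, y >>], so
   adjointness of [T] descends by injectivity. *)
have SS' : is_adjoint S S'.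
  move=> x y.
  have := adjE T (rank_one x) (rank_one y); rewrite TS TS' => TT.
  apply: (@rank_one_inj (regular_module A)).
  rewrite -!adj_rank_one -!comp_rank_one; exact: TT.
have Sadj : S \in @adjointable_pred R A E F.
  by apply/asboolP; split; [exact: mor TS|exists S' => //; exact: mor TS'].
by exists (Adjointable Sadj).
Qed.

(** [t] composed with [rank_one a] is [rank_one (t a)], so the values of [T t] are determined by [T]
    on rank-one multipliers. *)
Lemma multiplier_map_apply E F
    (T : @adjointable R (multiplier_algebra A) (multiplier E) (multiplier F))
    (S : adjointable E F) : (forall x, T (rank_one x) = rank_one (S x)) ->
  forall t : multiplier E, T t = adjointable_comp S t.
Proof.
move=> TS t; apply: adjointable_ext => a; apply: rank_one_inj.
rewrite -comp_rank_one -multiplier_mapM.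
by rewrite [X in T X](comp_rank_one t) TS.
Qed.

End Multipliers.

Theorem mainTheorem5 (R : realType) (A : locallyCstarType R)
    (E F : hilbertModType A)
    (T : @adjointable R (multiplier_algebra A) (multiplier E) (multiplier F)) :
  continuous (T : strict E -> strict F).
Proof.
have [S TS] := multiplier_map_restrict T.
have TE := multiplier_map_apply TS.
apply: seminormed_continuous => [s t|_ [p [a [y [Sp ->]]]]].
  by have [[TD _ _] _] := adjointableP T; exact: TD.
have [C C0 CP] := adjointable_bounded S Sp.
(* As [adj (T t) y = adj t (adj S y)], the second term is unchanged; [C] accounts for the first. *)
exists (strict_seminorm p a (adj S y)), (C + 1); split.
- by exists p, a, (adj S y).
- exact: addr_ge0.
move=> t; rewrite /strict_seminorm TE adj_comp /= mulrDl mulrDr.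
have [[sp _ _] _] := Sp.
have := CP (t a); have := pbar_ge0 p (t a).
have := seminorm_ge0 (adj t (adj S y)) sp.
nra.
Qed.
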